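(* Let $\mu=\mathcal{N}(m_\mu,\Sigma_\mu)$ and $\nu=\mathcal{N}(m_\nu,\Sigma_\nu)$ be Gaussian distributions on $\mathbb{R}^d$. Suppose that $\Sigma_\mu\Sigma_\nu=\Sigma_\nu\Sigma_\mu$ and let $P$ be an orthogonal matrix such that $D_\mu:=P\Sigma_\mu P^T$ and $D_\nu:=P\Sigma_\nu P^T$ are both diagonal. Setting $\bar D:=\min(D_\mu,D_\nu)$, the backward projection of $\mu$ on $\nu$ in the convex order is $\bar\mu=\mathcal{N}(m_\nu,\bar\Sigma)$, with $\bar\Sigma=P^T\bar D P$.
   Context: For diagonal matrices $D,D'$, $\min(D,D')$ denotes the entrywise minimum. $W_2$ is the quadratic Wasserstein distance. $\eta\leq_c\nu$ (convex order) means $\int h\,\mathrm{d}\eta\leq\int h\,\mathrm{d}\nu$ for every convex $h:\mathbb{R}^d\to\mathbb{R}$. The backward projection of $\mu$ on $\nu$ in the convex order is the measure $\bar\mu$ which is the unique minimizer of $W_2(\mu,\eta)$ over all $\eta\leq_c\nu$ (existence and uniqueness are known). Covariance matrices are symmetric positive semidefinite, possibly singular. *)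

(* Defs.v *)
From mathcomp Require Export all_boot all_order all_algebra.
From mathcomp Require Export all_classical all_reals all_analysis.

Set Implicit Arguments.
Unset Strict Implicit.
Unset Printing Implicit Defensive.

Import Order.TTheory GRing.Theory Num.Theory.
Import numFieldNormedType.Exports.

Local Open Scope classical_set_scope.
Local Open Scope ring_scope.

Section definitions.
Context {R : realType} {d : nat}.

(* R^d with its Borel sigma-algebra.  The carrier is convertible to 'cV[R]_d,
   whose topology (given by the sup norm) is the Euclidean one. *)
Definition Rd : Type := g_sigma_algebraType (@open 'cV[R]_d).

(* MathComp-Analysis measures are functions on all sets, whose values outside
   the sigma-algebra are irrelevant, so they are only compared on measurable
   sets. *)
Definition same_law (mu nu : set Rd -> \bar R) : Prop :=
  forall B : set Rd, measurable B -> mu B = nu B.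

(* The product of d copies of N(0, 1), determined by its values on
   measurable rectangles. *)
Definition is_standard_gaussian (gamma : probability Rd R) : Prop :=
  forall B : 'I_d -> set (measurableTypeR R), (forall i, measurable (B i)) ->
    gamma [set x : Rd | forall i, B i ((x : 'cV[R]_d) i ord0)]
      = (\prod_(i < d) normal_prob (0 : R) 1 (B i))%E.

(* mu = N(m, S): the law of m + A Z, where Z is a standard Gaussian vector and
   A *m A^T = S.  In particular S is symmetric positive semidefinite, and it
   may be singular. *)
Definition is_gaussian (m : 'cV[R]_d) (S : 'M[R]_d) (mu : probability Rd R)
    : Prop :=
  exists gamma : probability Rd R, exists A : 'M[R]_d,
    [/\ is_standard_gaussian gamma, A *m A^T = S &
        same_law mu (pushforward gamma (fun z : Rd => (m + A *m z : Rd)))].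

(* The norm of the library on 'cV[R]_d is the sup norm, hence this. *)
Definition sqr_dist (x y : 'cV[R]_d) : R := \sum_(i < d) (x i ord0 - y i ord0) ^+ 2.

Definition coupling (mu nu : probability Rd R) : set (probability (Rd * Rd)%type R) :=
  [set pi | same_law (pushforward pi (@fst Rd Rd)) mu /\
            same_law (pushforward pi (@snd Rd Rd)) nu].

(* W_2 takes its values in [0, +oo]. *)
Definition W2 (mu nu : probability Rd R) : \bar R :=
  (ereal_inf [set \int[pi]_z (sqr_dist z.1 z.2)%:E | pi in coupling mu nu]
     `^ 2^-1)%E.

(* When nu has a finite first moment, so does every eta below it (take for h
   the Euclidean norm), and then all these integrals are well defined in
   ]-oo, +oo]. *)
Definition convex_le (eta nu : probability Rd R) : Prop :=
  forall h : 'cV[R]_d -> R,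
    convex_function (E := 'cV[R]_d) [set: 'cV[R]_d] h ->
    (\int[eta]_x (h x)%:E <= \int[nu]_x (h x)%:E)%E.

Definition minimizes_W2_below (mu nu eta : probability Rd R) : Prop :=
  convex_le eta nu /\
  forall eta' : probability Rd R, convex_le eta' nu -> (W2 mu eta <= W2 mu eta')%E.

Definition is_backward_projection (mu nu mubar : probability Rd R) : Prop :=
  minimizes_W2_below mu nu mubar /\
  forall eta : probability Rd R, minimizes_W2_below mu nu eta -> same_law eta mubar.

End definitions.
Arguments Rd : clear implicits.

(* Main.v *)
(** In coordinates diagonalizing both covariances, mu is the law of the a_i Z_i
    and nu of the b_i Z_i, up to translations and a rotation, with Z standard;
    let T multiply the i-th coordinate by k_i = min(a_i, b_i) / a_i. Then mubar
    is the image of mu by T, and it is below nu since shrinking a coordinate of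
    Z averages the identity with a sign flip, which preserves the law of Z. For
    a coupling (x, y) of mu and eta <=_c nu, in each coordinate E y^2 <= b^2 and
    the means agree, so Cauchy-Schwarz gives E <x - Tx, Tx - y> >= 0, that is
    E|x - y|^2 >= E|x - Tx|^2 + E|Tx - y|^2. This yields both the optimality of
    mubar and its uniqueness. That a Gaussian law depends only on its mean and
    covariance comes from the invariance of the standard Gaussian law under
    Householder reflections, which are products of shears and a sign flip. *)

Require Import Defs.
From mathcomp Require Import ring lra measurable_realfun.

Set Implicit Arguments.
Unset Strict Implicit.
Unset Printing Implicit Defensive.

Import Order.TTheory GRing.Theory Num.Theory.
Import numFieldNormedType.Exports.
Local Open Scope classical_set_scope.
Local Open Scope ring_scope.

(** * Borel sets of R^d and boxes *)

Section borel.
Context {R : realType} {d : nat}.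

(** A Gaussian law comes with some standard Gaussian law and some [A] such that [A *m A^T] is its
    covariance, so nothing links the data behind mu, nu and mubar. The explicit maps between them
    require all three to be images of a single [gamma] under [P^T] times diagonal matrices; this is
    why invariance of [gamma] is needed. It is obtained by integration alone: weighting [gamma] by
    exp(|z|^2 / 2) gives a multiple of Lebesgue measure, for which a shear reduces to translating a
    one-dimensional integral, after resampling one coordinate. Convex test functions come with
    neither measurability nor integrability; both are derived from bounds on cubes, which give
    continuity and a global minorant of linear growth. Optimal couplings are not known to exist
    here, so uniqueness works with nearly optimal ones. Singular covariances need no separate proof:
    the quotients min(a_i, b_i) / a_i and min(a_i, b_i) / b_i are 0 when the denominator is, and
    then the numerator is 0 as well. *)

Definition box (B : 'I_d -> set R) : set (Rd R d) :=
  [set x : Rd R d | forall i, B i ((x : 'cV[R]_d) i ord0)].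

(** Balls of the sup norm are boxes, and rational endpoints indexed by a finite function form a
    countable type: the union is countable, so boxes generate the Borel sets. *)
Lemma open_bigcup_box (U : set 'cV[R]_d) : open U ->
  U = \bigcup_(q in [set q : {ffun 'I_d -> rat * rat} |
         box (fun i => `](ratr (q i).1), (ratr (q i).2)[%classic) `<=` U])
      box (fun i => `](ratr (q i).1), (ratr (q i).2)[%classic).
Proof.
move=> oU; apply/seteqP; split=> [x Ux|x [q /= qU qx]]; last exact: qU.
have [e e0 eU] : exists2 e : R, 0 < e & ball (x : 'cV[R]_d) e `<=` U.
  by have /nbhs_ballP[e /= e0 eU] := open_nbhs_nbhs (conj oU Ux); exists e.
have h i : exists q : rat * rat,
    [/\ x i ord0 - e < ratr q.1, ratr q.1 < x i ord0,
        x i ord0 < ratr q.2 & ratr q.2 < x i ord0 + e].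
  have [|q1 /[!in_itv]/= /andP[? ?]] := @rat_in_itvoo R (x i ord0 - e) (x i ord0).
    by rewrite ltrBlDr ltrDl.
  have [|q2 /[!in_itv]/= /andP[? ?]] := @rat_in_itvoo R (x i ord0) (x i ord0 + e).
    by rewrite ltrDl.
  by exists (q1, q2).
pose q := [ffun i => projT1 (cid (h i))].
exists q => [y /= qy|i] /=.
  apply: eU; split=> // i j; rewrite (ord1 j).
  have := qy i; rewrite /= in_itv/= ffunE.
  case: cid => -[q1 q2] /= [? ? ? ?] /andP[? ?].
  by rewrite /ball/= distrC ltr_distl; apply/andP; split; lra.
by rewrite ffunE /= in_itv/=; case: cid => -[q1 q2] /= [? -> -> ?].
Qed.

Lemma measurable_open_Rd (U : set 'cV[R]_d) : open U ->
  measurable (U : set (Rd R d)).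
Proof. by move=> oU; apply: sub_sigma_algebra. Qed.

Lemma continuous_measurable_Rd (h : 'cV[R]_d -> R) :
  continuous h -> measurable_fun setT (h : Rd R d -> R).
Proof.
move=> /continuousP ch; apply: (measurability _ (RGenOpens.measurableE R)).
move=> _ [_ [x [y ->]] <-]; rewrite setTI; apply: measurable_open_Rd.
exact/ch/interval_open.
Qed.

Lemma measurable_coord (i : 'I_d) :
  measurable_fun [set: Rd R d] (fun x : Rd R d => (x : 'cV[R]_d) i ord0).
Proof. by apply: continuous_measurable_Rd => x; exact: coord_continuous. Qed.

Lemma measurable_box (B : 'I_d -> set R) :
  (forall i, measurable (B i)) -> measurable (box B).
Proof.
move=> mB; rewrite (_ : box B = \bigcap_(i in [set: 'I_d])
    ((fun x : Rd R d => (x : 'cV[R]_d) i ord0) @^-1` B i)); last first.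
  by apply/seteqP; split=> x /= h i; [move=> _; exact: h|exact: (h i I)].
apply: fin_bigcap_measurable => // i _.
by rewrite -[X in measurable X]setTI; exact: measurable_coord.
Qed.

Lemma measurable_fun_Rd d' (T : measurableType d') (f : T -> Rd R d) :
  (forall i, measurable_fun setT (fun t => (f t : 'cV[R]_d) i ord0)) ->
  measurable_fun setT f.
Proof.
move=> mf; apply: (@measurability _ _ T (Rd R d) setT f (@open 'cV[R]_d)) => //.
move=> _ [U oU <-]; rewrite setTI (open_bigcup_box oU) preimage_bigcup.
rewrite bigcup_mkcond; apply: countable_bigcupT_measurable; first exact: countableP.
move=> q; case: ifP => // _.
rewrite (_ : f @^-1` _ = \bigcap_(i in [set: 'I_d])
    ((fun t => (f t : 'cV[R]_d) i ord0) @^-1`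
      `](ratr (q i).1), (ratr (q i).2)[%classic)); last first.
  by apply/seteqP; split=> x /= h i; [move=> _; exact: h|exact: (h i I)].
apply: fin_bigcap_measurable => // i _.
by rewrite -[X in measurable X]setTI; exact: mf.
Qed.

(** Boxes are stable under intersection and generate the Borel sets. *)
Lemma Rd_measure_unique (m1 : {finite_measure set (Rd R d) -> \bar R})
    (m2 : {measure set (Rd R d) -> \bar R}) :
  (forall B : 'I_d -> set R, (forall i, measurable (B i)) ->
    m1 (box B) = m2 (box B)) ->
  same_law m1 m2.
Proof.
move=> m12 B mB.
pose G := [set A : set (Rd R d) | exists2 B : 'I_d -> set R,
  (forall i, measurable (B i)) & A = box B].
apply: (@g_sigma_algebra_measure_unique _ _ _ G _ (fun=> setT)) => //.
- by move=> _ [C mC ->]; exact: measurable_box.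
- by move=> _; exists (fun=> setT) => //; apply/seteqP; split.
- by rewrite bigcup_const.
- move=> _ _ [C mC ->] [D mD ->]; exists (fun i => C i `&` D i).
    by move=> i; exact: measurableI.
  apply/seteqP; split=> x /=; first by move=> [xC xD] i; split.
  by move=> h; split=> i; have [] := h i.
- by move=> _ [C mC ->]; exact: m12.
- by move=> _; exact: fin_num_fun_lty.
- move: B mB; apply: smallest_sub; first exact: smallest_sigma_algebra.
  move=> U oU; rewrite (open_bigcup_box oU).
  rewrite bigcup_mkcond.
  apply: (@countable_bigcupT_measurable _ (g_sigma_algebraType G)).
    exact: countableP.
  move=> q; case: ifP => // _; apply: sub_sigma_algebra.
  by eexists; last by []; move=> i; exact: measurable_itv.
Qed.
End borel.

(** * Image laws *)

Section transfer.
Context d1 d2 (T1 : measurableType d1) (T2 : measurableType d2) (R : realType).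

(** [same_law] compares bare set functions, but a coupling has to be a bundled probability. *)
Definition law (P : probability T1 R) (f : T1 -> T2)
    (mf : measurable_fun setT f) : probability T2 R :=
  distribution P (mfun_Sub (mem_set mf)).

Lemma ge0_integral_law (P : probability T1 R) (f : T1 -> T2)
    (mf : measurable_fun setT f) (g : T2 -> \bar R) :
  measurable_fun setT g -> (forall y, 0 <= g y)%E ->
  (\int[law P mf]_y g y = \int[P]_x g (f x))%E.
Proof. by move=> mg g0; rewrite ge0_integral_distribution. Qed.

End transfer.

(** * One-dimensional Lebesgue and normal integrals *)

Section lebesgue_invariance.
Context {R : realType}.
Local Notation leb := (@lebesgue_measure R).

Lemma lebesgue_integralN (f : R -> \bar R) :
  measurable_fun setT f -> (forall x, 0 <= f x)%E ->
  (\int[leb]_x f (- x)%R = \int[leb]_x f x)%E.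
Proof.
move=> mf f0.
have mN : measurable_fun setT (fun x : measurableTypeR R => - x : measurableTypeR R).
  exact: oppr_measurable.
rewrite -(@ge0_integral_pushforward _ _ (measurableTypeR R) (measurableTypeR R) R
  (fun x => - x) mN leb setT f)//.
by apply: eq_measure_integral => A mA _; exact: lebesgue_measureN.
Qed.

Lemma lebesgue_integralD (c : R) (f : R -> \bar R) :
  measurable_fun setT f -> (forall x, 0 <= f x)%E ->
  (\int[leb]_x f (x + c)%R = \int[leb]_x f x)%E.
Proof.
move=> mf f0.
have mc : measurable_fun setT (fun x : measurableTypeR R => x + c : measurableTypeR R).
  exact: measurable_funD.
rewrite -(@ge0_integral_pushforward _ _ (measurableTypeR R) (measurableTypeR R) R
  (fun x => x + c) mc leb setT f)//.
apply: eq_measure_integral => A mA _; apply/esym/lebesgue_measure_unique => //.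
move=> _ [[a b] _ <-]; rewrite /pushforward/=.
transitivity (leb `]a - c, b - c]%classic).
  rewrite !lebesgue_measure_itv/= !lte_fin ltrD2r.
  by case: ifP => // _; rewrite -!EFinB; congr EFin; ring.
by congr (leb _); apply/seteqP; split=> x /=; rewrite !in_itv/= ltrBlDr lerBrDr.
Qed.

(** The change of variables involves the abstract Radon-Nikodym derivative; it equals the density
    almost everywhere, since both have the same integral over every measurable set. *)
Lemma ge0_integral_normal_prob (m s : R) (f : R -> \bar R) :
  measurable_fun setT f -> (forall x, 0 <= f x)%E ->
  (\int[normal_prob m s]_x f x = \int[leb]_x (f x * (normal_pdf m s x)%:E))%E.
Proof.
move=> mf f0.
have dom := normal_prob_dominates m s.
rewrite -(Radon_Nikodym_SigmaFinite.change_of_variables dom)//.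
have h2 := Radon_Nikodym_SigmaFinite.f_integrable dom.
have mpdf : measurable_fun setT (fun x => (normal_pdf m s x)%:E).
  by apply/measurable_EFinP; exact: measurable_normal_pdf.
apply: ae_eq_integral => //.
- by apply: emeasurable_funM => //; exact: (measurable_int _ h2).
- by apply: emeasurable_funM.
- apply: ae_eqe_mul2l; apply: integral_ae_eq => //= E _ mE.
  by rewrite -Radon_Nikodym_SigmaFinite.f_integral.
Qed.
End lebesgue_invariance.

(** * Resampling one coordinate *)

Section resample.
Context {R : realType} {d : nat}.
Implicit Type i : 'I_d.

Definition upd i (p : Rd R d * R) : Rd R d :=
  \col_j if j == i then p.2 else (p.1 : 'cV[R]_d) j ord0.

Lemma measurable_upd i : measurable_fun setT (upd i).
Proof.
apply: measurable_fun_Rd => j; rewrite /upd.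
under eq_fun do rewrite mxE.
case: eqP => _; first exact: measurable_snd.
by apply: (measurableT_comp (measurable_coord j)); exact: measurable_fst.
Qed.

Variable gamma : probability (Rd R d) R.
Hypothesis gammaP : is_standard_gaussian gamma.

(** Replacing one coordinate by an independent N(0, 1) variable preserves [gamma], as a comparison
    on boxes shows; Tonelli then isolates that coordinate in a one-dimensional integral. *)
Lemma integral_resample i (f : Rd R d -> \bar R) :
  measurable_fun setT f -> (forall x, 0 <= f x)%E ->
  (\int[gamma]_z f z = \int[gamma]_z \int[normal_prob 0 1]_t f (upd i (z, t)))%E.
Proof.
move=> mf f0.
have mu := measurable_upd i.
have gammaB (C : 'I_d -> set R) : (forall j, measurable (C j)) ->
    gamma (box C) = (\prod_(j < d) normal_prob (0 : R) 1 (C j))%E.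
  by move=> mC; exact: gammaP.
have gammaU (B : 'I_d -> set R) : (forall j, measurable (B j)) ->
  (gamma (box B) = gamma (box (fun j => if j == i then setT else B j)) *
    normal_prob (0 : R) 1 (B i))%E.
  move=> mB; rewrite !gammaB//; last by move=> j; case: ifP.
  rewrite (bigD1 i)//= [in RHS](bigD1 i)//= eqxx.
  rewrite probability_setT mul1e muleC; congr (_ * _)%E.
  by apply: eq_bigr => j /negbTE ->.
pose Q := law (gamma \x (normal_prob 0 1 : probability (measurableTypeR R) R))%E mu.
rewrite -(@fubini_tonelli1 _ _ _ _ R gamma
  (normal_prob 0 1 : probability (measurableTypeR R) R) (f \o upd i)) //.
- transitivity (\int[Q]_z f z)%E; last by rewrite /Q ge0_integral_law.
  apply: eq_measure_integral => A mA _.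
  apply: (@Rd_measure_unique _ _ gamma Q) => // B mB.
  transitivity ((gamma \x normal_prob 0 1)%E (upd i @^-1` box B)) => //.
  rewrite (_ : upd i @^-1` box B =
    box (fun j => if j == i then setT else B j) `*` B i).
    rewrite product_measure1E//; [ | |exact: mB]; last first.
      by apply: measurable_box => j; case: ifP.
    exact: gammaU.
  apply/seteqP; split=> [[z t]|[z t]] /= h.
    split=> [j|]; last by have := h i; rewrite mxE eqxx.
    by case: ifPn => // ji; have := h j; rewrite mxE (negbTE ji).
  move=> j; rewrite mxE /=; case: eqP => [->|/eqP ji]; first by case: h.
  by case: h => /(_ j); rewrite (negbTE ji).
- exact: measurableT_comp.
- by move=> x /=.
Qed.
End resample.

(** * Lebesgue measure seen through the Gaussian law *)

Section rotation.
Context {R : realType} {d : nat}.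
Implicit Types (i : 'I_d) (z : Rd R d).

Variable gamma : probability (Rd R d) R.
Hypothesis gammaP : is_standard_gaussian gamma.

Definition sqn (z : 'cV[R]_d) : R := \sum_j z j ord0 ^+ 2.

(* [f] integrated against the Lebesgue measure, up to a constant factor. *)
Definition lebint (f : Rd R d -> \bar R) : \bar R :=
  (\int[gamma]_z (f z * (expR (sqn z / 2))%:E))%E.

Definition lebinv (T : Rd R d -> Rd R d) : Prop :=
  measurable_fun setT T /\
  forall f, measurable_fun setT f -> (forall z, 0 <= f z)%E ->
    lebint (f \o T) = lebint f.

Lemma lebinv_comp T1 T2 : lebinv T1 -> lebinv T2 -> lebinv (T1 \o T2).
Proof.
move=> [m1 h1] [m2 h2]; split; first exact: measurableT_comp.
move=> f mf f0; rewrite -[RHS]h1// -[RHS]h2//; last by move=> z /=.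
exact: measurableT_comp.
Qed.

Lemma measurable_sqn : measurable_fun setT (sqn : Rd R d -> R).
Proof.
apply: measurable_sum => j; apply: measurable_funX; exact: measurable_coord.
Qed.

Lemma sqn_upd i z t : sqn (upd i (z, t)) = t ^+ 2 + \sum_(j | j != i) z j ord0 ^+ 2.
Proof.
rewrite /sqn (bigD1 i)//= mxE eqxx; congr (_ + _).
by apply: eq_bigr => j ji; rewrite mxE (negbTE ji).
Qed.

Lemma measurable_upd2 i z : measurable_fun setT (fun t : R => upd i (z, t)).
Proof. by apply: (measurableT_comp (measurable_upd i)); exact: measurable_pair1. Qed.

(** The part exp(t^2 / 2) of the weight cancels the exponential in the density of the resampled
    coordinate; Lebesgue measure and the constant [normal_peak 1] remain. *)
Lemma lebint_resample i f : measurable_fun setT f -> (forall z, 0 <= f z)%E ->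
  lebint f = (\int[gamma]_z
    ((expR ((\sum_(j | j != i) z j ord0 ^+ 2) / 2) * normal_peak 1)%:E *
     \int[lebesgue_measure]_t f (upd i (z, t))))%E.
Proof.
move=> mf f0; rewrite /lebint (integral_resample gammaP i); last 2 first.
- apply: emeasurable_funM => //; apply/measurable_EFinP.
  apply: measurableT_comp => //; apply: measurable_funM => //; exact: measurable_sqn.
- by move=> z; rewrite mule_ge0// lee_fin expR_ge0.
apply: eq_integral => z _.
have mfu : measurable_fun setT (fun t => f (upd i (z, t))).
  by apply: measurableT_comp => //; exact: measurable_upd2.
rewrite ge0_integral_normal_prob; last 2 first.
- apply: emeasurable_funM => //; apply/measurable_EFinP.
  apply: measurableT_comp => //; apply: measurable_funM => //.
  apply: (measurableT_comp measurable_sqn).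
  exact: measurable_upd2.
- by move=> t; rewrite mule_ge0// lee_fin expR_ge0.
rewrite -ge0_integralZl//; last first.
  by rewrite lee_fin mulr_ge0 ?expR_ge0 ?normal_peak_ge0.
apply: eq_integral => t _; rewrite -muleA -EFinM [RHS]muleC; congr (_ * _%:E)%E.
rewrite normal_pdfE ?oner_eq0// /normal_fun sqn_upd mulrCA mulrC; congr (_ * _).
by rewrite -expRD; congr expR; rewrite subr0 expr1n; lra.
Qed.

(** Since [l] ignores the i-th coordinate, the inner integral over that coordinate is merely
    translated by a constant. *)
Lemma lebinv_shear i (l : Rd R d -> R) : measurable_fun setT l ->
  (forall z t, l (upd i (z, t)) = l z) ->
  lebinv (fun z => upd i (z, z i ord0 + l z)).
Proof.
move=> ml li.
have mT : measurable_fun setT (fun z => upd i (z, z i ord0 + l z)).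
  apply: (measurableT_comp (measurable_upd i)); apply: measurable_fun_pair => //.
  by apply: measurable_funD => //; exact: measurable_coord.
split=> // f mf f0; rewrite (lebint_resample i); first last.
- by move=> z /=.
- exact: (measurableT_comp mf mT).
rewrite (lebint_resample i mf f0).
apply: eq_integral => z _; congr (_ * _)%E.
rewrite -[RHS](lebesgue_integralD (l z))//; last first.
  by apply: measurableT_comp => //; exact: measurable_upd2.
apply: eq_integral => t _ /=; rewrite li; congr f.
by apply/colP => j; rewrite !mxE; case: eqP => //; rewrite eqxx.
Qed.

Lemma lebinv_flip i : lebinv (fun z => upd i (z, - z i ord0)).
Proof.
have mT : measurable_fun setT (fun z => upd i (z, - z i ord0)).
  apply: (measurableT_comp (measurable_upd i)); apply: measurable_fun_pair => //.
  by apply: measurableT_comp => //; exact: measurable_coord.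
split=> // f mf f0; rewrite (lebint_resample i); first last.
- by move=> z /=.
- exact: (measurableT_comp mf mT).
rewrite (lebint_resample i mf f0).
apply: eq_integral => z _; congr (_ * _)%E.
rewrite -[RHS](lebesgue_integralN)//; last first.
  by apply: measurableT_comp => //; exact: measurable_upd2.
apply: eq_integral => t _ /=; congr f.
by apply/colP => j; rewrite !mxE; case: eqP => //; rewrite eqxx.
Qed.

(** The Gaussian density with respect to Lebesgue measure depends on the norm alone: the invariance
    is applied to [f] times exp(-|z|^2 / 2). *)
Lemma lebinv_isometry (T : Rd R d -> Rd R d) (f : Rd R d -> \bar R) :
  lebinv T -> (forall z, sqn (T z) = sqn z) ->
  measurable_fun setT f -> (forall z, 0 <= f z)%E ->
  (\int[gamma]_z f (T z) = \int[gamma]_z f z)%E.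
Proof.
move=> [mT hT] nT mf f0.
have := hT (fun z => f z * (expR (- (sqn z / 2)))%:E)%E.
rewrite /lebint /= => h.
transitivity (\int[gamma]_z
    (f (T z) * (expR (- (sqn (T z) / 2)))%:E * (expR (sqn z / 2))%:E))%E.
  apply: eq_integral => z _.
  by rewrite nT -muleA -EFinM -expRD addNr expR0 mule1.
rewrite h.
- by apply: eq_integral => z _; rewrite -muleA -EFinM -expRD addNr expR0 mule1.
- apply: (emeasurable_funM mf); apply/measurable_EFinP.
  apply: (measurableT_comp (@measurable_expR R)).
  apply: (measurableT_comp (@oppr_measurable R setT)).
  apply: measurable_funM; first exact: measurable_sqn.
  exact: measurable_cst.
- by move=> z; rewrite mule_ge0// lee_fin expR_ge0.
Qed.
End rotation.

(** * Reflections and Gram matrices *)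

Section householder.
Context {R : realType} {d : nat}.
Implicit Types (i : 'I_d) (z : Rd R d) (u v w : 'cV[R]_d).

Lemma measurable_affine d' (m : 'cV[R]_d') (A : 'M[R]_(d', d)) :
  measurable_fun setT (fun z : Rd R d => m + A *m z : Rd R d').
Proof.
apply: measurable_fun_Rd => i.
under eq_fun do rewrite !mxE.
apply: measurable_funD => //; apply: measurable_sum => j.
by apply: measurable_funM => //; exact: measurable_coord.
Qed.

Lemma sqnE v : sqn v = (v^T *m v) ord0 ord0.
Proof. by rewrite mxE; apply: eq_bigr => j _; rewrite mxE expr2. Qed.

Lemma sqn_eq0 v : sqn v = 0 -> v = 0.
Proof.
move=> /eqP; rewrite psumr_eq0; last by move=> j _; exact: sqr_ge0.
move=> /allP v0; apply/colP => j; rewrite mxE; apply/eqP.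
by have := v0 j (mem_index_enum _); rewrite sqrf_eq0.
Qed.

(** The reflection in the hyperplane orthogonal to [v]; it is the identity for [v = 0]. *)
Definition householder v : 'M[R]_d := 1%:M - (2 / sqn v) *: (v *m v^T).

Lemma householder_tr v : (householder v)^T = householder v.
Proof. by rewrite /householder linearB/= trmx1 linearZ/= trmx_mul trmxK. Qed.

Lemma householder_sqr v : householder v *m householder v = 1%:M.
Proof.
have [->|v0] := eqVneq v 0.
  by rewrite /householder mul0mx scaler0 subr0 mulmx1.
have N0 : sqn v != 0 by apply: contra_neq v0; exact: sqn_eq0.
rewrite /householder; set V := v *m v^T; set c := 2 / sqn v.
have VV : V *m V = sqn v *: V.
  rewrite /V mulmxA -(mulmxA v) [v^T *m v]mx11_scalar -sqnE mul_mx_scalar.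
  by rewrite -scalemxAl.
rewrite mulmxBr mulmx1 mulmxBl mul1mx -scalemxAl -scalemxAr VV !scalerA.
rewrite -addrA -[RHS]addr0; congr (_ + _).
rewrite -opprD addrA -scalerDl -scalerBl.
by rewrite (_ : _ + _ = 0) ?scale0r ?oppr0// /c; field.
Qed.

Lemma householder_mul v (z : 'cV[R]_d) :
  householder v *m z = z - (2 * (\sum_j v j ord0 * z j ord0) / sqn v) *: v.
Proof.
rewrite /householder mulmxBl mul1mx -scalemxAl -mulmxA [v^T *m z]mx11_scalar.
rewrite mul_mx_scalar scalerA mxE; congr (_ - _ *: _).
rewrite [RHS]mulrAC; congr (_ * _).
by apply: eq_bigr => j _; rewrite mxE.
Qed.

Variable gamma : probability (Rd R d) R.
Hypothesis gammaP : is_standard_gaussian gamma.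

(** A product of shears, one per coordinate, all driven by the i-th coordinate, which none of them
    moves because [w] vanishes there. *)
Lemma lebinv_col i w : w i ord0 = 0 ->
  lebinv gamma (fun z => \col_k (z k ord0 + z i ord0 * w k ord0)).
Proof.
move=> wi0.
(* Only the coordinates listed in [s] have been sheared; over the full enumeration the sum is the
   k-th entry of [w]. *)
suff h (s : seq 'I_d) : lebinv gamma (fun z =>
    \col_k (z k ord0 + z i ord0 * \sum_(j <- s) w j ord0 * (k == j)%:R)).
  have := h (index_enum 'I_d); congr lebinv; apply/funext => z.
  apply/colP => k; rewrite !mxE; congr (_ + _ * _).
  rewrite (bigD1 k)//= eqxx mulr1 big1 ?addr0// => j jk.
  by rewrite eq_sym (negbTE jk) mulr0.
elim: s => [|j s ih].
  rewrite (_ : (fun _ => _) = id).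
    by split=> //; exact: measurable_id.
  by apply/funext => z; apply/colP => k; rewrite mxE big_nil mulr0 addr0.
have [||] := @lebinv_comp _ _ gamma _ _ (@lebinv_shear _ _ gamma gammaP j
  (fun z => z i ord0 * w j ord0) _ _) ih.
- by apply: measurable_funM => //; exact: measurable_coord.
- move=> z t; rewrite mxE; case: eqP => [<-|//].
  by rewrite wi0 !mulr0.
move=> m1 m2; have : lebinv gamma _ := conj m1 m2.
congr lebinv; apply/funext => z /=; apply/colP => k; rewrite !mxE big_cons.
have -> : \sum_(l <- s) w l ord0 * (i == l)%:R = 0.
  rewrite big1// => l _; case: eqP => [<-|_]; first by rewrite wi0 mul0r.
  by rewrite mulr0.
by have [->|kj] := eqVneq k j => /=; ring.
Qed.

Lemma lebinv_householder v : lebinv gamma (fun z => householder v *m z).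
Proof.
have [->|v0] := eqVneq v 0.
  rewrite (_ : (fun _ => _) = id).
    by split=> //; exact: measurable_id.
  by apply/funext => z; rewrite householder_mul scaler0 subr0.
have N0 : sqn v != 0 by apply: contra_neq v0; exact: sqn_eq0.
have [i vi0] : exists i, v i ord0 != 0.
  apply: contra_notP (elimN eqP v0) => /forallNP h; apply/colP => i.
  by rewrite mxE; apply/eqP/negPn/negP.
pose c j := v j ord0 / v i ord0.
have shear (a : R) : lebinv gamma
    (fun z => upd i (z, z i ord0 + a * \sum_(j | j != i) c j * z j ord0)).
  apply: (lebinv_shear gammaP).
    apply: measurable_funM => //; under eq_fun do rewrite big_mkcond.
    apply: measurable_sum => j; case: (j != i) => //.
    by apply: measurable_funM => //; exact: measurable_coord.
  move=> z t /=; congr (_ * _); apply: eq_bigr => j ji; by rewrite mxE (negbTE ji).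
(* Writing v z = v_i q, the reflection subtracts 2 v_i v_j q / |v|^2 from the j-th coordinate; [w]
   gathers these coefficients of [q] for j != i. *)
pose w : 'cV[R]_d := \col_j (if j == i then 0 else - (2 * v i ord0 * v j ord0 / sqn v)).
have wi0 : w i ord0 = 0 by rewrite mxE eqxx.
(* A shear takes [v z / v_i] as the new i-th coordinate; in these coordinates
   the reflection is a sign flip after adding multiples of it to the others. *)
have := lebinv_comp (shear (-1)) (lebinv_comp (lebinv_flip gammaP i)
  (lebinv_comp (lebinv_col wi0) (shear 1))).
congr lebinv; apply/funext => z /=; apply/colP => k.
rewrite householder_mul [RHS]mxE [X in _ = _ + X]mxE [X in _ = _ - X]mxE.
set q := z i ord0 + 1 * _; set y := \col_k0 (_ + _ * _).
have qE : \sum_j v j ord0 * z j ord0 = v i ord0 * q.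
  rewrite (bigD1 i)//= /q mul1r mulrDr mulr_sumr; congr (_ + _).
  by apply: eq_bigr => j _; rewrite /c; field.
have yi : y i ord0 = q by rewrite !mxE eqxx mulr0 addr0.
have yj j : j != i -> y j ord0 = z j ord0 - q * (2 * v i ord0 * v j ord0 / sqn v).
  by move=> ji; rewrite !mxE eqxx (negbTE ji) mulrN.
rewrite qE mxE /=; have [->|ki] := eqVneq k i; last first.
  by rewrite mxE (negbTE ki) yj//; ring.
rewrite mxE eqxx /= yi.
have -> : \sum_(j < d | j != i) c j * upd i (y, - q) j ord0 =
    (\sum_(j < d | j != i) c j * z j ord0) -
    q * 2 / sqn v * \sum_(j < d | j != i) v j ord0 ^+ 2.
  rewrite mulr_sumr -sumrB; apply: eq_bigr => j ji.
  by rewrite mxE (negbTE ji) /= yj// /c; field; apply/andP.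
have -> : \sum_(j < d | j != i) v j ord0 ^+ 2 = sqn v - v i ord0 ^+ 2.
  by rewrite /sqn [in RHS](bigD1 i)//= addrAC subrr add0r.
rewrite (_ : \sum_(j < d | j != i) c j * z j ord0 = q - z i ord0); last first.
  by rewrite /q; ring.
by field.
Qed.

Definition gaussian_invariant (Q : 'M[R]_d) := forall f : Rd R d -> \bar R,
  measurable_fun setT f -> (forall z, 0 <= f z)%E ->
  (\int[gamma]_z f (Q *m z : Rd R d) = \int[gamma]_z f z)%E.

Lemma measurable_mulmx (Q : 'M[R]_d) :
  measurable_fun setT (fun z : Rd R d => Q *m z : Rd R d).
Proof.
rewrite (_ : (fun z : Rd R d => _) = fun z : Rd R d => 0 + Q *m z).
  exact: measurable_affine.
by apply/funext => z; rewrite add0r.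
Qed.

Lemma gaussian_invariant_mul Q1 Q2 :
  gaussian_invariant Q1 -> gaussian_invariant Q2 ->
  gaussian_invariant (Q1 *m Q2).
Proof.
move=> h1 h2 f mf f0; rewrite -(h1 f)// -(h2 (fun z => f (Q1 *m z : Rd R d)))//; last first.
  exact: (measurableT_comp mf (measurable_mulmx Q1)).
by apply: eq_integral => z _; rewrite mulmxA.
Qed.

Lemma gaussian_invariant_householder v : gaussian_invariant (householder v).
Proof.
move=> f mf f0; apply: lebinv_isometry => //; first exact: lebinv_householder.
move=> z; rewrite !sqnE trmx_mul householder_tr mulmxA -(mulmxA z^T).
by rewrite householder_sqr mulmx1.
Qed.

(* The rows of [A] are moved one by one onto those of [B]: equality of the Gram
   matrices makes each new reflection fix the rows already in place. *)
Lemma gram_eq_gaussian_invariant d' (A B : 'M[R]_(d', d)) :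
  A *m A^T = B *m B^T ->
  exists2 Q, gaussian_invariant Q & A *m Q = B.
Proof.
move=> AB.
suff h k : (k <= d')%N -> exists Q, [/\ gaussian_invariant Q,
    (A *m Q) *m (A *m Q)^T = B *m B^T &
    forall i : 'I_d', (i < k)%N -> row i (A *m Q) = row i B].
  have [Q [Qi _ hQ]] := h _ (leqnn d'); exists Q => //.
  by apply/row_matrixP => i; exact: hQ.
elim: k => [_|k ih kd].
  exists 1%:M; split; rewrite ?mulmx1// => f _ _.
  by under eq_integral do rewrite mul1mx.
have [Q [Qi CB hQ]] := ih (ltnW kd).
set C := A *m Q in CB hQ.
pose k0 := Ordinal kd.
(* Two vectors of equal norm are exchanged by the reflection along their difference; the norms agree
   by the diagonal entry of the Gram identity. *)
pose v : 'cV[R]_d := (row k0 C - row k0 B)^T.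
exists (Q *m householder v); rewrite mulmxA -/C; split.
- by apply: gaussian_invariant_mul => //; exact: gaussian_invariant_householder.
- by rewrite trmx_mul householder_tr mulmxA -(mulmxA C) householder_sqr mulmx1.
have rowH (i : 'I_d') : row i (C *m householder v) =
    row i C - (2 / sqn v * (row i C *m v) ord0 ord0) *: v^T.
  rewrite row_mul /householder mulmxBr mulmx1 -scalemxAr mulmxA.
  by rewrite [row i C *m v]mx11_scalar mul_scalar_mx scalerA -mx11_scalar.
have rowrow (M N : 'M[R]_(d', d)) (i j : 'I_d') : (row i M *m (row j N)^T) ord0 ord0 =
    (M *m N^T) i j.
  by rewrite !mxE; apply: eq_bigr => l _; rewrite !mxE.
have rowv (i : 'I_d') : (row i C *m v) ord0 ord0 =
    (B *m B^T) i k0 - (row i C *m (row k0 B)^T) ord0 ord0.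
  by rewrite /v linearB/= mulmxBr mxE [X in _ + X]mxE rowrow CB.
move=> i; rewrite ltnS leq_eqVlt => /orP[/eqP ik|ik]; last first.
  by rewrite rowH rowv hQ// rowrow subrr mulr0 scale0r subr0.
have {ik} -> : i = k0 by exact: val_inj.
have [v0|v0] := eqVneq (sqn v) 0.
  have /(congr1 trmx) := sqn_eq0 v0; rewrite /v trmxK linear0 => /eqP.
  by rewrite subr_eq0 rowH v0 invr0 mulr0 mul0r scale0r subr0 => /eqP.
rewrite rowH (_ : _ * _ = 1).
  by rewrite scale1r /v trmxK opprB addrC subrK.
(* For |p| = |q|, |p - q|^2 = 2 <p, p - q>, so exactly one copy of [v] is subtracted. *)
suff E : sqn v = 2 * (row k0 C *m v) ord0 ord0.
  by rewrite E in v0 *; field; apply: contra_neq v0 => ->; rewrite mulr0.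
have rowBv : (row k0 B *m v) ord0 ord0 =
    (row k0 C *m (row k0 B)^T) ord0 ord0 - (B *m B^T) k0 k0.
  rewrite {1}/v linearB/= mulmxBr mxE [X in _ + X]mxE !rowrow; congr (_ - _).
  by rewrite -[B *m C^T]trmxK trmx_mul trmxK mxE.
rewrite sqnE {1}/v trmxK mulmxBl mxE [X in _ + X]mxE rowBv rowv; ring.
Qed.
End householder.

(** * Bounds and continuity of convex functions *)

Section convex_functions.
Context {R : realType} {d : nat}.
Implicit Types (i : 'I_d) (x u w : 'cV[R]_d) (h : 'cV[R]_d -> R).

Definition convexf h := forall (t : R) x y, 0 <= t -> t <= 1 ->
  h (t *: x + (1 - t) *: y) <= t * h x + (1 - t) * h y.

Lemma convex_functionP h :
  convex_function (E := 'cV[R]_d) [set: 'cV[R]_d] h <-> convexf h.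
Proof.
split=> [ch t x y t0 t1|ch t x y _ _].
  have t01 : Itv.spec (@Itv.num_sem R) (Itv.Real `[0%Z, 1%Z]) t.
    by rewrite /Itv.spec/= /Itv.num_sem/= num_real in_itv/= t0.
  have := ch (Itv.mk t01) x y (in_setT _) (in_setT _).
  by rewrite !convRE.
have := ch t%:num x y; rewrite ge0 le1 => /(_ isT isT); rewrite convRE; exact.
Qed.

Definition norm1 w : R := \sum_i `|w i ord0|.

Lemma norm1_ge0 w : 0 <= norm1 w. Proof. by apply: sumr_ge0. Qed.

(** On a cube a convex function is bounded by its values at the vertices. The induction is on the
    coordinates allowed to vary; the base point is general because the two ends of an edge shift
    it. *)
Lemma convex_upper_bound h x : convexf h -> exists M, forall u,
  (forall i, `|u i ord0| <= 1) -> h (x + u) <= M.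
Proof.
move=> ch; suff H (s : seq 'I_d) x' : exists M, forall u,
    (forall i, `|u i ord0| <= 1) -> (forall i, i \notin s -> u i ord0 = 0) ->
    h (x' + u) <= M.
  have [M hM] := H (enum 'I_d) x; exists M => u u1; apply: hM => // i.
  by rewrite mem_enum.
elim: s x' => [|i s ih] x'.
  exists (h x') => u _ u0; rewrite (_ : u = 0) ?addr0//.
  by apply/colP => i; rewrite u0// mxE.
have [M1 h1] := ih (x' + delta_mx i ord0); have [M2 h2] := ih (x' - delta_mx i ord0).
exists (Num.max M1 M2) => u u1 us.
pose v : 'cV[R]_d := \col_j if j == i then 0 else u j ord0.
have uE : u = v + u i ord0 *: delta_mx i ord0.
  apply/colP => j; rewrite !mxE eqxx andbT.
  by have [->|ji] := eqVneq j i; rewrite ?add0r ?mulr1 ?mulr0 ?addr0.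
(* The weight with t * 1 + (1 - t) * (-1) = u_i, which places the point between two opposite faces
   of the cube. *)
pose t := (1 + u i ord0) / 2.
have := u1 i; rewrite ler_norml => /andP[ui0 ui1].
have t0 : 0 <= t by rewrite /t; lra.
have t1 : t <= 1 by rewrite /t; lra.
rewrite (_ : x' + u = t *: (x' + delta_mx i ord0 + v)
    + (1 - t) *: (x' - delta_mx i ord0 + v)); last first.
  by rewrite {1}uE; apply/colP => j; rewrite !mxE /t; field.
apply: le_trans (ch _ _ _ t0 t1) _.
have v1 j : `|v j ord0| <= 1 by rewrite mxE; case: ifP => // _; rewrite normr0 ler01.
have vs j : j \notin s -> v j ord0 = 0.
  by move=> js; rewrite mxE; case: eqP => // /eqP ji; apply: us; rewrite inE negb_or ji.
have {h1} h1 := h1 v v1 vs; have {h2} h2 := h2 v v1 vs.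
have : t * h (x' + delta_mx i ord0 + v) <= t * Num.max M1 M2.
  by apply: ler_wpM2l => //; rewrite le_max h1.
have : (1 - t) * h (x' - delta_mx i ord0 + v) <= (1 - t) * Num.max M1 M2.
  by apply: ler_wpM2l; [rewrite subr_ge0|rewrite le_max h2 orbT].
lra.
Qed.

(** With w = t u and [u] in the unit cube, [x] is a convex combination of [x + w] and [x - u], so
    the upper bound on the cube turns into a lower bound at [x + w]. This lower bound is global and
    serves as an integrable minorant; the local upper bound is for continuity. *)
Lemma convex_growth h x : convexf h -> exists2 K, 0 <= K & forall w,
  h x - K * norm1 w <= h (x + w) /\
  (norm1 w <= 1 -> h (x + w) <= h x + K * norm1 w).
Proof.
move=> ch; have [M hM] := convex_upper_bound x ch.
have xM : h x <= M.
  by have := hM 0; rewrite addr0; apply=> i; rewrite mxE normr0 ler01.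
exists (M - h x) => [|w]; first by rewrite subr_ge0.
set t := norm1 w.
have t0 : 0 <= t by exact: norm1_ge0.
have [tz|tn0] := eqVneq t 0.
  have -> : w = 0.
    apply/colP => i; rewrite mxE; apply/eqP; rewrite -normr_le0 -tz.
    by rewrite /t /norm1 (bigD1 i)//= lerDl sumr_ge0.
  by rewrite addr0 tz !mulr0 subr0 addr0; split.
have tp : 0 < t by rewrite lt_neqAle eq_sym tn0.
have [u u1 wE] : exists2 u : 'cV[R]_d, forall i, `|u i ord0| <= 1 & w = t *: u.
  exists (t^-1 *: w) => [i|]; last by rewrite scalerA divff// scale1r.
  rewrite mxE normrM gtr0_norm ?invr_gt0// mulrC ler_pdivrMr// mul1r.
  by rewrite /t /norm1 (bigD1 i)//= lerDl sumr_ge0.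
have Nu1 i : `|(- u) i ord0| <= 1 by rewrite mxE normrN u1.
split=> [|t1].
  have s0 : 0 <= (1 + t)^-1 by rewrite invr_ge0; lra.
  have s1 : (1 + t)^-1 <= 1 by rewrite invf_le1; lra.
  have t1n0 : 1 + t != 0 by rewrite gt_eqF//; lra.
  have := ch _ (x + w) (x - u) s0 s1.
  rewrite (_ : _ *: _ + _ *: _ = x); last first.
    by rewrite wE; apply/colP => i; rewrite !mxE; field.
  have := hM _ Nu1.
  move=> h1 h2.
  have h3 : (1 + t) * h x <= h (x + w) + t * h (x - u).
    have -> : h (x + w) + t * h (x - u) =
      (1 + t) * ((1 + t)^-1 * h (x + w) + (1 - (1 + t)^-1) * h (x - u)).
      by field.
    by apply: ler_wpM2l => //; lra.
  have : t * h (x - u) <= t * M by apply: ler_wpM2l.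
  by lra.
have := ch _ (x + u) x t0 t1.
rewrite (_ : _ *: _ + _ *: _ = x + w); last first.
  by rewrite wE; apply/colP => i; rewrite !mxE; ring.
have : t * h (x + u) <= t * M by apply: ler_wpM2l => //; exact: hM.
by lra.
Qed.

Lemma convex_continuous h : convexf h -> continuous h.
Proof.
move=> ch x; have [K K0 hK] := convex_growth x ch.
move=> A /= /(nbhs_ballP (h x))[e' /= e'0 eA].
have [e e0 ee'] : exists2 e, 0 < e & e < e' by exists (e' / 2); lra.
(* The upper half of [convex_growth] requires the bound 1. [K + 1] is positive even for [K = 0], and
   [d.+1] below covers dimension 0. *)
pose r := Num.min 1 (e / (K + 1)).
have r0 : 0 < r by rewrite lt_min ltr01 divr_gt0//; lra.
have d0 : (0 : R) < d.+1%:R by rewrite ltr0n.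
apply/nbhs_ballP; exists (r / d.+1%:R) => [|y [_ xy]] /=; first exact: divr_gt0.
pose w : 'cV[R]_d := y - x.
have := hK w; rewrite (_ : x + w = y); last by rewrite /w addrC subrK.
move=> [h1 h2].
have wr : norm1 w <= r.
  apply: le_trans (_ : \sum_(i < d) r / d.+1%:R <= _).
    apply: ler_sum => i _; rewrite !mxE distrC; apply/ltW; exact: xy.
  rewrite sumr_const card_ord -[X in X <= _]mulr_natr mulrAC ler_pdivrMr//.
  rewrite ler_pM2l// ler_nat.
  exact: leqnSn.
have wK : norm1 w <= e / (K + 1) by apply: le_trans wr _; rewrite ge_min lexx orbT.
have w1 : norm1 w <= 1 by apply: le_trans wr _; rewrite ge_min lexx.
have h3 : K * norm1 w <= e.
  apply: le_trans (_ : (K + 1) * norm1 w <= _).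
    by rewrite ler_wpM2r ?norm1_ge0//; lra.
  by rewrite mulrC -ler_pdivlMr//; lra.
have {}h2 := h2 w1.
apply: eA; rewrite /ball/=; apply: le_lt_trans ee'; rewrite ler_norml.
by apply/andP; split; lra.
Qed.

End convex_functions.

(** * Integrability and expectation *)

Section expectation.
Context d (T : measurableType d) (R : realType) (P : probability T R).
Implicit Types f g : T -> R.

Definition intg f := P.-integrable setT (EFin \o f).

Lemma intg_measurable f : intg f -> measurable_fun setT f.
Proof. by move=> /measurable_int /measurable_EFinP. Qed.

Lemma intgD f g : intg f -> intg g -> intg (fun x => f x + g x).
Proof. by move=> hf hg; have := integrableD measurableT hf hg. Qed.

Lemma intgB f g : intg f -> intg g -> intg (fun x => f x - g x).
Proof. by move=> hf hg; have := integrableB measurableT hf hg. Qed.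

Lemma intgZ c f : intg f -> intg (fun x => c * f x).
Proof. by move=> hf; have := integrableZl measurableT c hf. Qed.

Lemma intgN f : intg f -> intg (fun x => - f x).
Proof. by move=> hf; have := integrableN hf. Qed.

Lemma intg_cst c : intg (fun=> c).
Proof. exact: finite_measure_integrable_cst. Qed.

Lemma intg_sum (I : Type) (s : seq I) (p : pred I) (f : I -> T -> R) :
  (forall i, intg (f i)) -> intg (fun x => \sum_(i <- s | p i) f i x).
Proof.
move=> hf; have := integrable_sum measurableT s (fun i (_ : p i) => hf i).
by congr integrable; apply/funext => x /=; rewrite sumEFin.
Qed.

Lemma intg_le f g : measurable_fun setT f -> intg g ->
  (forall x, `|f x| <= g x) -> intg f.
Proof.
move=> mf hg fg; apply: (le_integrable measurableT _ _ hg).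
  exact/measurable_EFinP.
by move=> x _ /=; rewrite lee_fin (le_trans (fg x))// ler_norm.
Qed.

Lemma intg_between f g h : measurable_fun setT f -> intg g -> intg h ->
  (forall x, g x <= f x <= h x) -> intg f.
Proof.
move=> mf hg hh gfh.
apply: (@intg_le _ (fun x => `|g x| + `|h x|)) => //.
  by apply: intgD; exact: integrable_norm.
move=> x; have /andP[gf fh] := gfh x.
rewrite ler_norml; apply/andP; split.
  by have := lerNnormlW (lexx `|g x|); have := normr_ge0 (h x); lra.
by have := ler_norm (h x); have := normr_ge0 (g x); lra.
Qed.

Lemma intg_mul f g : measurable_fun setT f -> measurable_fun setT g ->
  intg (fun x => f x ^+ 2) -> intg (fun x => g x ^+ 2) ->
  intg (fun x => f x * g x).
Proof.
move=> mf mg hf hg; apply: (intg_le _ (intgD hf hg)).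
  exact: measurable_funM.
move=> x; rewrite ler_norml; apply/andP; split; nra.
Qed.

Lemma intg_sqr f : measurable_fun setT f -> intg (fun x => f x ^+ 2) -> intg f.
Proof.
move=> mf hf; apply: (intg_le mf (intgD (intg_cst 1) hf)).
move=> x; rewrite ler_norml; apply/andP; split; nra.
Qed.

Definition expect f : R := \int[P]_x f x.

Lemma expectD f g : intg f -> intg g ->
  expect (fun x => f x + g x) = expect f + expect g.
Proof. exact: RintegralD. Qed.

Lemma expectB f g : intg f -> intg g ->
  expect (fun x => f x - g x) = expect f - expect g.
Proof. exact: RintegralB. Qed.

Lemma expectZ c f : intg f -> expect (fun x => c * f x) = c * expect f.
Proof. exact: RintegralZl. Qed.

Lemma expect_sum (I : Type) (s : seq I) (f : I -> T -> R) :
  (forall i, intg (f i)) ->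
  expect (fun x => \sum_(i <- s) f i x) = \sum_(i <- s) expect (f i).
Proof.
move=> hf; elim: s => [|i s ih].
  rewrite big_nil /expect (_ : (fun _ => _) = fun=> 0).
    by rewrite Rintegral_cst// mul0r.
  by apply/funext => x; rewrite big_nil.
rewrite big_cons -ih -expectD//; last exact: intg_sum.
by congr expect; apply/funext => x; rewrite big_cons.
Qed.

Lemma le_expect f g : intg f -> intg g -> (forall x, f x <= g x) ->
  expect f <= expect g.
Proof. by move=> hf hg fg; apply: le_Rintegral. Qed.

Lemma expectE f : intg f -> (\int[P]_x (f x)%:E = (expect f)%:E)%E.
Proof. by move=> hf; rewrite fineK//; exact: integrable_fin_num. Qed.

Lemma intg_ge0 f : measurable_fun setT f -> (forall x, 0 <= f x) ->
  (\int[P]_x (f x)%:E < +oo)%E -> intg f.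
Proof.
move=> mf f0 foo; apply/integrableP; split; first exact/measurable_EFinP.
by under eq_integral do rewrite /= ger0_norm//.
Qed.

(** The negative part of [f] is dominated by that of [g], hence has finite integral, so an infinite
    positive part would make the integral of [f] infinite. *)
Lemma intg_minorant f g : measurable_fun setT f -> intg g ->
  (forall x, g x <= f x) -> (\int[P]_x (f x)%:E < +oo)%E -> intg f.
Proof.
move=> mf hg gf foo.
have mEf : measurable_fun setT (EFin \o f) by exact/measurable_EFinP.
have hn : (\int[P]_x ((EFin \o f)^\- x) < +oo)%E.
  apply: le_lt_trans (integral_funeneg_lt_pinfty measurableT hg).
  apply: ge0_le_integral => //.
  - exact: measurable_funeneg.
  - by apply: measurable_funeneg; exact: (measurable_int _ hg).
  - by move=> x _; rewrite !funenegE /= ge_max !le_max lexx orbT andbT lee_fin lerN2 gf.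
have hp : (\int[P]_x ((EFin \o f)^\+ x) < +oo)%E.
  rewrite ltNge leye_eq; apply: contraTN foo => /eqP fp.
  rewrite integralE fp -leNgt addye ?leey//.
  suff /fineK <- : (\int[P]_x ((EFin \o f)^\- x))%E \is a fin_num by [].
  by rewrite ge0_fin_numE// integral_ge0.
apply/integrableP; split=> //.
rewrite (_ : (fun x => _) = abse \o (EFin \o f))// fune_abse.
rewrite ge0_integralD//; first exact: lte_add_pinfty.
- exact: measurable_funepos.
- exact: measurable_funeneg.
Qed.

End expectation.

(** * Integrals against an image law *)

Section transfer_law.
Context d1 (T : measurableType d1) (R : realType) (d : nat).
Variables (P : probability T R) (mu : probability (Rd R d) R).
Variables (phi : T -> Rd R d) (mphi : measurable_fun setT phi).
Hypothesis muP : same_law mu (pushforward P phi).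

(** Integrability is not assumed, as convex test functions may have infinite integrals: positive and
    negative parts are transferred separately. *)
Lemma integral_same_law (f : Rd R d -> \bar R) : measurable_fun setT f ->
  (\int[mu]_x f x = \int[P]_x f (phi x))%E.
Proof.
move=> mf; transitivity (\int[law P mphi]_x f x)%E.
  by apply: eq_measure_integral => A mA _; exact: muP.
rewrite integralE [RHS]integralE; congr (_ - _)%E.
- rewrite ge0_integral_law//; last exact: measurable_funepos.
  by apply: eq_integral => x _; rewrite !funeposE.
- rewrite ge0_integral_law//; last exact: measurable_funeneg.
  by apply: eq_integral => x _; rewrite !funenegE.
Qed.

Lemma intg_same_law (f : Rd R d -> R) : measurable_fun setT f ->
  intg mu f <-> intg P (f \o phi).
Proof.
move=> mf; split=> /integrableP[_ foo]; apply/integrableP; split.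
- by apply/measurable_EFinP; exact: measurableT_comp.
- rewrite -(@integral_same_law (fun x => `|(f x)%:E|%E))//.
  by apply: measurableT_comp => //; exact/measurable_EFinP.
- exact/measurable_EFinP.
- rewrite (@integral_same_law (fun x => `|(f x)%:E|%E))//.
  by apply: measurableT_comp => //; exact/measurable_EFinP.
Qed.

Lemma expect_same_law (f : Rd R d -> R) : measurable_fun setT f ->
  expect mu f = expect P (f \o phi).
Proof.
move=> mf; rewrite /expect /Rintegral (@integral_same_law (EFin \o f))//.
exact/measurable_EFinP.
Qed.

End transfer_law.

(** * Second moment of N(0, 1) *)

Section second_moment.
Context {R : realType}.

(* It is 1, but only its finiteness matters. *)
Definition normal_moment2 : R :=
  fine (\int[normal_prob (0 : R) 1]_t (t ^+ 2)%:E)%E.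

(** The integrand t^2 times the N(0, 1) density is dominated by a multiple of the density with
    standard deviation 2, whose integral is 1. *)
Lemma normal_moment2_lty :
  (\int[normal_prob (0 : R) 1]_t (t ^+ 2)%:E < +oo)%E.
Proof.
rewrite ge0_integral_normal_prob; last 2 first.
- by apply/measurable_EFinP; exact: exprn_measurable.
- by move=> x; rewrite lee_fin sqr_ge0.
(* The exponents differ by x^2 / 2 - x^2 / 8 = 3 x^2 / 8, and exp(3 x^2 / 8) >= 3 x^2 / 8 gives the
   factor 8 / 3; the peaks adjust the normalization. *)
set c : R := 8 / 3 * normal_peak 1 / normal_peak 2.
have p2 : 0 < normal_peak (2 : R) by exact: normal_peak_gt0.
apply: (@le_lt_trans _ _ (\int[lebesgue_measure]_x
    (c%:E * (normal_pdf 0 2 x)%:E))%E); last first.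
  rewrite ge0_integralZl//.
  - by rewrite integral_normal_pdf mule1 ltry.
  - by apply/measurable_EFinP; exact: measurable_normal_pdf.
  - by move=> x _; rewrite lee_fin normal_pdf_ge0.
  - by rewrite lee_fin !mulr_ge0 ?normal_peak_ge0 ?invr_ge0 ?normal_peak_ge0.
apply: ge0_le_integral => //.
- by move=> x _; rewrite lee_fin mulr_ge0 ?sqr_ge0// normal_pdf_ge0.
- apply/measurable_EFinP/measurable_funM; first exact: exprn_measurable.
  exact: measurable_normal_pdf.
- apply/measurable_EFinP/measurable_funM => //; exact: measurable_normal_pdf.
move=> x _; rewrite -EFinM lee_fin !normal_pdfE// /normal_fun subr0.
set a := expR _; set b := expR _.
have -> : c * (normal_peak 2 * b) = normal_peak 1 * (8 / 3 * b).
  by rewrite /c; field; rewrite gt_eqF.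
rewrite mulrCA ler_wpM2l ?normal_peak_ge0//.
have -> : b = expR (3 / 8 * x ^+ 2) * a.
  by rewrite -expRD; congr expR; rewrite expr1n; field.
rewrite mulrA ler_wpM2r ?expR_ge0//.
have := expR_ge1Dx (3 / 8 * x ^+ 2); lra.
Qed.

Lemma normal_moment2_ge0 : 0 <= normal_moment2.
Proof. by apply: fine_ge0; apply: integral_ge0 => x _; rewrite lee_fin sqr_ge0. Qed.
End second_moment.

(** * Moments, symmetry and uniqueness of Gaussian laws *)

Section gaussian_law.
Context {R : realType} {d : nat}.
Variable gamma : probability (Rd R d) R.
Hypothesis gammaP : is_standard_gaussian gamma.
Implicit Type i : 'I_d.

Lemma invariant_same_law (T : Rd R d -> Rd R d) : measurable_fun setT T ->
  (forall f : Rd R d -> \bar R, measurable_fun setT f ->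
    (forall z, 0 <= f z)%E -> (\int[gamma]_z f (T z) = \int[gamma]_z f z)%E) ->
  same_law gamma (pushforward gamma T).
Proof.
move=> mT hT A mA.
have E (B : set (Rd R d)) : measurable B ->
    (\int[gamma]_z (\1_B z)%:E = gamma B)%E.
  by move=> mB; rewrite integral_indic// setIT.
rewrite -E// -(hT (fun z => (\1_A z)%:E)).
- rewrite /pushforward -E; last by rewrite -[X in measurable X]setTI; exact: mT.
  by apply: eq_integral => z _; rewrite !indicE.
- by apply/measurable_EFinP; exact: measurable_indic.
- by move=> z /=; rewrite lee_fin.
Qed.

Lemma integral_gaussian_coord i (g : R -> \bar R) : measurable_fun setT g ->
  (forall t, 0 <= g t)%E ->
  (\int[gamma]_z g (z i ord0) = \int[normal_prob (0 : R) 1]_t g t)%E.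
Proof.
move=> mg g0; rewrite (integral_resample gammaP i)//; last first.
  by apply: (measurableT_comp mg); exact: measurable_coord.
have cstE c : (\int[gamma]_z (cst c z) = c)%E.
  transitivity (c * gamma setT)%E; first exact: integral_cst.
  by rewrite probability_setT mule1.
rewrite -[RHS]cstE; apply: eq_integral => z _.
by apply: eq_integral => t _; rewrite mxE eqxx.
Qed.

Lemma intg_coord_sqr i : intg gamma (fun z => z i ord0 ^+ 2).
Proof.
apply: intg_ge0 => [|z|].
- by apply: measurable_funX; exact: measurable_coord.
- exact: sqr_ge0.
rewrite (@integral_gaussian_coord i (fun t => (t ^+ 2)%:E)).
- exact: normal_moment2_lty.
- by apply/measurable_EFinP; exact: exprn_measurable.
- by move=> t; rewrite lee_fin sqr_ge0.
Qed.

Lemma expect_coord_sqr i : expect gamma (fun z => z i ord0 ^+ 2) = normal_moment2.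
Proof.
rewrite /expect /Rintegral (@integral_gaussian_coord i (fun t => (t ^+ 2)%:E))//.
- by apply/measurable_EFinP; exact: exprn_measurable.
- by move=> t; rewrite lee_fin sqr_ge0.
Qed.

Lemma intg_coord i : intg gamma (fun z => z i ord0).
Proof. by apply: intg_sqr; [exact: measurable_coord|exact: intg_coord_sqr]. Qed.

Definition flip i (z : Rd R d) : Rd R d := upd i (z, - z i ord0).

Lemma measurable_flip i : measurable_fun setT (flip i).
Proof. by have [] := lebinv_flip gammaP i. Qed.

Lemma flip_same_law i : same_law gamma (pushforward gamma (flip i)).
Proof.
apply: invariant_same_law; first exact: measurable_flip.
move=> f mf f0; apply: (lebinv_isometry (lebinv_flip gammaP i)) => // z.
by rewrite sqn_upd sqrrN /sqn [RHS](bigD1 i).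
Qed.

Lemma expect_coord i : expect gamma (fun z => z i ord0) = 0.
Proof.
have := expect_same_law (measurable_flip i) (flip_same_law i) (measurable_coord i).
rewrite (_ : _ \o flip i = fun z => -1 * z i ord0).
  by rewrite expectZ ?mulN1r; [lra|exact: intg_coord].
by apply/funext => z /=; rewrite mxE eqxx mulN1r.
Qed.

(** Both choices hidden in [is_gaussian] become free: standard Gaussian laws coincide because they
    agree on boxes, and two matrices with Gram matrix [S] differ by some [Q] preserving [gamma]. *)
Lemma gaussian_law m (S A : 'M[R]_d) (mu : probability (Rd R d) R) :
  is_gaussian m S mu -> A *m A^T = S ->
  same_law mu (pushforward gamma (fun z : Rd R d => (m + A *m z : Rd R d))).
Proof.
move=> [gamma' [A' [g'P A'S muE]]] AS B mB; rewrite muE//.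
have gg : same_law gamma' gamma.
  apply: Rd_measure_unique => C mC.
  by transitivity (\prod_(i < d) normal_prob (0 : R) 1 (C i))%E;
    [exact: g'P|exact/esym/gammaP].
have mpre M : measurable ((fun z : Rd R d => (m + M *m z : Rd R d)) @^-1` B).
  by rewrite -[X in measurable X]setTI; exact: measurable_affine.
rewrite /pushforward gg//.
have [Q Qi A'Q] := gram_eq_gaussian_invariant gammaP (etrans A'S (esym AS)).
rewrite (invariant_same_law (measurable_mulmx Q) Qi)// /pushforward.
by congr (gamma _); apply/seteqP; split=> z /=; rewrite mulmxA A'Q.
Qed.

End gaussian_law.

(** * Dilations and the convex order *)

Section gaussian_convex_order.
Context {R : realType} {d : nat}.
Variable gamma : probability (Rd R d) R.
Hypothesis gammaP : is_standard_gaussian gamma.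
Implicit Types (i : 'I_d) (g h : 'cV[R]_d -> R) (k c : 'I_d -> R).

Lemma convexf_affine d' (h : 'cV[R]_d' -> R) m (A : 'M[R]_(d', d)) :
  convexf h -> convexf (fun z : 'cV[R]_d => h (m + A *m z)).
Proof.
move=> ch t x y t0 t1; apply: le_trans (ch _ _ _ t0 t1).
rewrite le_eqVlt; apply/orP; left; apply/eqP; congr h.
rewrite mulmxDr -!scalemxAr !scalerDr addrACA -scalerDl.
by rewrite (_ : t + _ = 1) ?scale1r//; ring.
Qed.

Lemma convex_measurable h : convexf h -> measurable_fun setT (h : Rd R d -> R).
Proof. by move=> ch; apply: continuous_measurable_Rd; exact: convex_continuous. Qed.

Lemma intg_norm1 : intg gamma (@norm1 R d).
Proof. by apply: intg_sum => i; exact: integrable_norm (intg_coord gammaP i). Qed.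

Definition dilation c (z : 'cV[R]_d) : 'cV[R]_d := \col_j (c j * z j ord0).

Lemma dilationE c z : dilation c z = diag_mx (\row_j c j) *m z.
Proof. by apply/colP => j; rewrite mul_diag_mx !mxE. Qed.

Lemma convexf_dilation c g : convexf g -> convexf (g \o dilation c).
Proof.
move=> /(convexf_affine 0 (diag_mx (\row_j c j))); congr convexf.
by apply/funext => z; rewrite /= dilationE add0r.
Qed.

(** Integrability of [g'] is proved along the way: it lies between its minorant of linear growth and
    the average of [g] and [g \o flip i]. *)
Lemma dilation_coord_expect i (a : R) g : 0 <= a -> a <= 1 -> convexf g ->
  intg gamma g ->
  let g' := g \o dilation (fun j => if j == i then a else 1) in
  intg gamma g' /\ expect gamma g' <= expect gamma g.
Proof.
move=> a0 a1 cg ig g'.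
have mg := convex_measurable cg.
have cg' : convexf g' by exact: convexf_dilation.
have igf : intg gamma (g \o flip i).
  exact/(intg_same_law (measurable_flip gammaP i) (flip_same_law gammaP i) mg).
(* Chosen so that b - (1 - b) = a. *)
pose b : R := (1 + a) / 2.
have b0 : 0 <= b by rewrite /b; lra.
have b1 : b <= 1 by rewrite /b; lra.
have iu : intg gamma (fun z => b * g z + (1 - b) * (g \o flip i) z).
  by apply: intgD; exact: intgZ.
have g'u z : g' z <= b * g z + (1 - b) * (g \o flip i) z.
  apply: le_trans (cg _ _ _ b0 b1); rewrite le_eqVlt; apply/orP; left.
  apply/eqP; congr g; apply/colP => j; rewrite !mxE /b.
  by case: eqP => [->|_] /=; field.
have [K K0 hK] := convex_growth 0 cg'.
have ig' : intg gamma g'.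
  apply: (intg_between (convex_measurable cg') _ iu).
    exact: (intgB (intg_cst gamma (g' 0)) (intgZ K intg_norm1)).
  by move=> z; have [h1 _] := hK z; rewrite add0r in h1; rewrite h1 g'u.
split=> //; apply: le_trans (le_expect ig' iu g'u) _.
rewrite expectD; [|exact: intgZ|exact: intgZ].
rewrite !expectZ//.
rewrite -(expect_same_law (measurable_flip gammaP i) (flip_same_law gammaP i) mg).
by rewrite le_eqVlt; apply/orP; left; apply/eqP; ring.
Qed.

Lemma dilation_expect k g : (forall i, 0 <= k i <= 1) -> convexf g ->
  intg gamma g ->
  intg gamma (g \o dilation k) /\ expect gamma (g \o dilation k) <= expect gamma g.
Proof.
move=> k01 cg ig.
(* One factor [k j] per occurrence of [j] in [s]; the enumeration contains each index once, so there
   [c] is [k]. *)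
pose c (s : seq 'I_d) j := \prod_(l <- s) (if l == j then k j else 1).
suff H s : forall g, convexf g -> intg gamma g ->
    intg gamma (g \o dilation (c s)) /\
    expect gamma (g \o dilation (c s)) <= expect gamma g.
  have := H (index_enum 'I_d) g cg ig.
  rewrite (_ : c _ = k)//; apply/funext => j.
  rewrite /c (bigD1 j)//= eqxx big1 ?mulr1// => l /negbTE lj.
  by rewrite lj.
elim: s => [|i s ih] {cg ig}g cg ig.
  rewrite (_ : _ \o _ = g); first by split.
  apply/funext => z /=; congr g; apply/colP => j.
  by rewrite mxE /c big_nil mul1r.
have /andP[ki0 ki1] := k01 i.
have [ig' le1] := dilation_coord_expect i ki0 ki1 cg ig.
have [ig'' le2] := ih _ (convexf_dilation _ cg) ig'.
rewrite (_ : _ \o dilation (c (i :: s)) =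
    (g \o dilation (fun j => if j == i then k i else 1)) \o dilation (c s)).
  by split=> //; exact: le_trans le2 le1.
apply/funext => z /=; congr g; apply/colP => j; rewrite !mxE /c big_cons mulrA.
by rewrite eq_sym; case: eqP => [->|].
Qed.

(** Either the right-hand side is infinite and the bound is trivial, or the minorant of linear
    growth makes [g] integrable. *)
Lemma dilation_integral k g : (forall i, 0 <= k i <= 1) -> convexf g ->
  (\int[gamma]_z (g (dilation k z))%:E <= \int[gamma]_z (g z)%:E)%E.
Proof.
move=> k01 cg.
have [goo|] := ltP (\int[gamma]_z (g z)%:E)%E +oo%E; last first.
  by rewrite leye_eq => /eqP ->; rewrite leey.
have mg := convex_measurable cg.
have [K K0 hK] := convex_growth 0 cg.
have ig : intg gamma g.
  apply: (@intg_minorant _ (Rd R d) R gamma g (fun z => g 0 - K * norm1 z)) => //.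
    exact: (intgB (intg_cst gamma (g 0)) (intgZ K intg_norm1)).
  by move=> z; have [h1 _] := hK z; rewrite add0r in h1.
have [ig' le1] := dilation_expect k01 cg ig.
rewrite (@expectE _ (Rd R d) R gamma g ig).
by rewrite (@expectE _ (Rd R d) R gamma (g \o dilation k) ig') lee_fin.
Qed.

Lemma gaussian_convex_le (m : 'cV[R]_d) (A : 'M[R]_d) k
    (eta nu : probability (Rd R d) R) :
  (forall i, 0 <= k i <= 1) ->
  same_law nu (pushforward gamma (fun z : Rd R d => (m + A *m z : Rd R d))) ->
  same_law eta (pushforward gamma
    (fun z : Rd R d => (m + (A *m diag_mx (\row_i k i)) *m z : Rd R d))) ->
  convex_le eta nu.
Proof.
move=> k01 nuE etaE h /convex_functionP ch.
have mh : measurable_fun setT (fun z : Rd R d => (h z)%:E).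
  by apply/measurable_EFinP; exact: convex_measurable.
rewrite (integral_same_law (measurable_affine _ _) etaE)//.
rewrite (integral_same_law (measurable_affine _ _) nuE)//.
have := dilation_integral k01 (convexf_affine m A ch).
apply: le_trans; rewrite le_eqVlt; apply/orP; left; apply/eqP.
by apply: eq_integral => z _; rewrite dilationE mulmxA.
Qed.

End gaussian_convex_order.

(** * Cauchy-Schwarz and the sign of the cross term *)

Section covariance_bound.
Context d (T : measurableType d) (R : realType) (Q : probability T R).

(** The right-hand side of the assumption has infimum 2 a b s, reached at t = b / a when both are
    positive, and otherwise approached as [t] tends to infinity or to 0. *)
Lemma le_geometric_mean (a b s B : R) : 0 <= a -> 0 <= b -> 0 <= s ->
  (forall t, 0 < t -> 2 * B <= t * (a ^+ 2 * s) + t^-1 * (b ^+ 2 * s)) ->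
  B <= a * b * s.
Proof.
move=> a0 b0 s0 h.
have as0 : 0 <= a ^+ 2 * s by rewrite mulr_ge0 ?sqr_ge0.
have bs0 : 0 <= b ^+ 2 * s by rewrite mulr_ge0 ?sqr_ge0.
have [az|an] := eqVneq a 0.
  rewrite az !mul0r leNgt; apply/negP => B0.
  (* Large enough for t^-1 b^2 s to be less than [B]; the added 1 keeps [t] positive and the
     inequality strict. *)
  have t0 : 0 < (b ^+ 2 * s + 1) / B by rewrite divr_gt0//; lra.
  have := h _ t0; rewrite az expr0n/= mul0r mulr0 add0r invf_div mulrAC.
  by rewrite ler_pdivlMr; nra.
have [bz|bn] := eqVneq b 0.
  rewrite bz mulr0 mul0r leNgt; apply/negP => B0.
  have t0 : 0 < B / (a ^+ 2 * s + 1) by rewrite divr_gt0//; lra.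
  have := h _ t0; rewrite bz expr0n/= mul0r mulr0 addr0 mulrAC.
  by rewrite ler_pdivlMr; nra.
have t0 : 0 < b / a by rewrite divr_gt0// lt_neqAle eq_sym ?an ?bn.
have := h _ t0.
rewrite (_ : _ + _ = 2 * (a * b * s)); last by field; apply/andP.
by rewrite ler_pM2l.
Qed.

(** Taking expectations in 2 X Y <= t X^2 + Y^2 / t, for every t > 0. *)
Lemma expect_mul_le (X Y : T -> R) (a b s : R) : 0 <= a -> 0 <= b -> 0 <= s ->
  measurable_fun setT X -> measurable_fun setT Y ->
  intg Q (fun x => X x ^+ 2) -> intg Q (fun x => Y x ^+ 2) ->
  expect Q (fun x => X x ^+ 2) <= a ^+ 2 * s ->
  expect Q (fun x => Y x ^+ 2) <= b ^+ 2 * s ->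
  expect Q (fun x => X x * Y x) <= a * b * s.
Proof.
move=> a0 b0 s0 mX mY iX iY eX eY; apply: le_geometric_mean => // t t0.
have iXY := intg_mul mX mY iX iY.
rewrite -expectZ//.
apply: (@le_trans _ _ (expect Q (fun x => t * X x ^+ 2 + t^-1 * Y x ^+ 2))).
  apply: le_expect; [exact: intgZ|by apply: intgD; exact: intgZ|move=> x].
  rewrite -subr_ge0.
  rewrite (_ : _ - _ = t * (X x - t^-1 * Y x) ^+ 2); last by field; rewrite gt_eqF.
  by rewrite mulr_ge0 ?sqr_ge0// ltW.
rewrite expectD; [|exact: intgZ|exact: intgZ].
rewrite !expectZ//; apply: lerD; first by rewrite ler_pM2l.
by rewrite ler_pM2l ?invr_gt0.
Qed.

(** This is one coordinate of E <x - Tx, Tx - y>, with [e] the difference of the means. Centering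
    removes [e] and leaves (1 - k) (k E X^2 - E XY). For 0 < a <= b the first factor is 0; for b <
    a, k a^2 s = a b s bounds E XY; for a = 0, k = 0 and E XY <= 0. *)
Lemma cross_term_ge0 (X Y : T -> R) (e a b s : R) : 0 <= a -> 0 <= b -> 0 <= s ->
  measurable_fun setT X -> measurable_fun setT Y ->
  intg Q (fun x => X x ^+ 2) -> intg Q (fun x => Y x ^+ 2) ->
  expect Q X = 0 -> expect Q Y = 0 ->
  expect Q (fun x => X x ^+ 2) = a ^+ 2 * s ->
  expect Q (fun x => Y x ^+ 2) <= b ^+ 2 * s ->
  let k := Num.min a b / a in
  let f x := (e + (1 - k) * X x) * (k * X x - Y x) in
  intg Q f /\ 0 <= expect Q f.
Proof.
move=> a0 b0 s0 mX mY iX2 iY2 eX eY eX2 eY2 k f.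
have iXY := intg_mul mX mY iX2 iY2.
have iX := intg_sqr mX iX2; have iY := intg_sqr mY iY2.
have fE : f = fun x => (e * k * X x - e * Y x) +
    (((1 - k) * k) * X x ^+ 2 - (1 - k) * (X x * Y x)).
  by apply/funext => x; rewrite /f; ring.
have i1 : intg Q (fun x => e * k * X x - e * Y x) by apply: intgB; exact: intgZ.
have i2 : intg Q (fun x => ((1 - k) * k) * X x ^+ 2 - (1 - k) * (X x * Y x)).
  by apply: intgB; exact: intgZ.
rewrite fE; split; first exact: intgD.
rewrite expectD// expectB; [|exact: intgZ|exact: intgZ].
rewrite expectB; [|exact: intgZ|exact: intgZ].
rewrite !expectZ// eX eY !mulr0 subr0 add0r -mulrA -mulrBr eX2.
have B : expect Q (fun x => X x * Y x) <= a * b * s.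
  by apply: expect_mul_le => //; rewrite eX2.
have [az|an] := eqVneq a 0.
  by rewrite /k az invr0 mulr0 subr0 mul1r mul0r sub0r; move: B; rewrite az; lra.
have ap : 0 < a by rewrite lt_neqAle eq_sym an.
rewrite /k; case: (leP a b) => [ab|ba]; first by rewrite divff// subrr mul0r.
apply: mulr_ge0.
  by rewrite subr_ge0 ler_pdivrMr// mul1r ltW.
by rewrite subr_ge0 (_ : _ / _ * _ = a * b * s)//; field.
Qed.
End covariance_bound.

(** * Coordinates diagonalizing the covariances *)

Section rotated_coordinates.
Context {R : realType} {d : nat}.
Variables (P : 'M[R]_d).
Hypothesis PP : P *m P^T = 1%:M.
Implicit Types (m x y : 'cV[R]_d) (i : 'I_d).

Definition rcoord m i x : R := (P *m (x - m)) i ord0.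

Lemma sqr_dist_rcoord x y : sqr_dist x y = \sum_i (P *m (x - y)) i ord0 ^+ 2.
Proof.
transitivity (sqn (x - y)); first by apply: eq_bigr => i _; rewrite !mxE.
rewrite -/(sqn _) !sqnE trmx_mul mulmxA -(mulmxA _ P^T P).
by rewrite (mulmx1C PP) mulmx1.
Qed.

Lemma rcoord_gaussian m i (a : 'I_d -> R) (z : 'cV[R]_d) :
  rcoord m i (m + (P^T *m diag_mx (\row_j a j)) *m z) = a i * z i ord0.
Proof.
by rewrite /rcoord addrAC subrr add0r !mulmxA PP mul1mx mul_diag_mx !mxE.
Qed.

Lemma measurable_rcoord m i : measurable_fun setT (rcoord m i : Rd R d -> R).
Proof.
rewrite (_ : rcoord m i = (fun x : Rd R d => (x : 'cV[R]_d) i ord0) \o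
    (fun x : Rd R d => - (P *m m) + P *m x : Rd R d)).
  by apply: (measurableT_comp (measurable_coord i)); exact: measurable_affine.
by apply/funext => x /=; rewrite /rcoord mulmxBr addrC.
Qed.

Lemma rcoord_comb m i (t : R) x y :
  rcoord m i (t *: x + (1 - t) *: y) = t * rcoord m i x + (1 - t) * rcoord m i y.
Proof.
rewrite /rcoord (_ : _ - m = t *: (x - m) + (1 - t) *: (y - m)).
  by rewrite mulmxDr -!scalemxAr !mxE.
by apply/colP => j; rewrite !mxE; ring.
Qed.

(** The convex order is exploited through this function, its opposite and its square: the first two
    equate the means, the third bounds the second moments. *)
Lemma convexf_rcoord m i : convexf (rcoord m i).
Proof. by move=> t x y _ _; rewrite rcoord_comb. Qed.

Lemma convexf_rcoordN m i : convexf (fun x => - rcoord m i x).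
Proof. by move=> t x y _ _; rewrite rcoord_comb; lra. Qed.

Lemma convexf_rcoord_sqr m i : convexf (fun x => rcoord m i x ^+ 2).
Proof.
move=> t x y t0 t1; rewrite rcoord_comb -subr_ge0.
set p := rcoord m i x; set q := rcoord m i y.
rewrite (_ : _ - _ = t * (1 - t) * (p - q) ^+ 2); last by ring.
by apply: mulr_ge0; [apply: mulr_ge0 => //; lra|exact: sqr_ge0].
Qed.

Variable gamma : probability (Rd R d) R.
Hypothesis gammaP : is_standard_gaussian gamma.

(** Maps a standard Gaussian vector to one of law N(m, P^T diag(a_i^2) P). *)
Definition rgauss m (a : 'I_d -> R) (z : Rd R d) : Rd R d :=
  m + (P^T *m diag_mx (\row_j a j)) *m z.

Lemma measurable_rgauss m a : measurable_fun setT (rgauss m a).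
Proof. exact: measurable_affine. Qed.

Section moments.
Variables (m : 'cV[R]_d) (a : 'I_d -> R) (mu : probability (Rd R d) R).
Hypothesis muE : same_law mu (pushforward gamma (rgauss m a)).
Variable i : 'I_d.

Let mr : measurable_fun setT (rcoord m i : Rd R d -> R) := measurable_rcoord m i.
Let mr2 : measurable_fun setT (fun x : Rd R d => rcoord m i x ^+ 2) :=
  measurable_funX 2 mr.

Let rcoordE : (fun x : Rd R d => rcoord m i x) \o rgauss m a = fun z => a i * z i ord0.
Proof. by apply/funext => z /=; rewrite rcoord_gaussian. Qed.

Let rcoord2E : (fun x : Rd R d => rcoord m i x ^+ 2) \o rgauss m a =
  fun z => a i ^+ 2 * z i ord0 ^+ 2.
Proof. by apply/funext => z /=; rewrite rcoord_gaussian exprMn. Qed.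

Lemma intg_rcoord_sqr : intg mu (fun x => rcoord m i x ^+ 2).
Proof.
apply/(intg_same_law (measurable_rgauss m a) muE mr2).
by rewrite rcoord2E; apply: intgZ; exact: intg_coord_sqr.
Qed.

Lemma expect_rcoord_sqr :
  expect mu (fun x => rcoord m i x ^+ 2) = a i ^+ 2 * normal_moment2.
Proof.
rewrite (expect_same_law (measurable_rgauss m a) muE mr2) rcoord2E.
by rewrite expectZ ?expect_coord_sqr//; exact: intg_coord_sqr.
Qed.

Lemma expect_rcoord : expect mu (rcoord m i) = 0.
Proof.
rewrite (expect_same_law (measurable_rgauss m a) muE mr) rcoordE.
by rewrite expectZ ?expect_coord ?mulr0//; exact: intg_coord.
Qed.

Variable eta : probability (Rd R d) R.
Hypothesis etamu : convex_le eta mu.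

Lemma convex_le_intg_sqr : intg eta (fun x => rcoord m i x ^+ 2).
Proof.
apply: intg_ge0 => //; first by move=> x; exact: sqr_ge0.
apply: le_lt_trans (etamu ((convex_functionP _).2 (@convexf_rcoord_sqr m i))) _.
by rewrite (expectE intg_rcoord_sqr) ltry.
Qed.

Lemma convex_le_expect_sqr :
  expect eta (fun x => rcoord m i x ^+ 2) <= a i ^+ 2 * normal_moment2.
Proof.
rewrite -expect_rcoord_sqr -lee_fin -(expectE intg_rcoord_sqr).
rewrite -(expectE convex_le_intg_sqr).
exact: (etamu ((convex_functionP _).2 (@convexf_rcoord_sqr m i))).
Qed.

Lemma convex_le_expect : expect eta (rcoord m i) = 0.
Proof.
have ie : intg eta (rcoord m i) by exact: intg_sqr mr convex_le_intg_sqr.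
have im : intg mu (rcoord m i) by exact: intg_sqr mr intg_rcoord_sqr.
have := etamu ((convex_functionP _).2 (@convexf_rcoord m i)).
have := etamu ((convex_functionP _).2 (@convexf_rcoordN m i)).
rewrite (expectE ie) (expectE im) (expectE (intgN ie)) (expectE (intgN im)).
rewrite !lee_fin expect_rcoord.
have N (Q : probability (Rd R d) R) (f : Rd R d -> R) :
    intg Q f -> expect Q (fun x => - f x) = - expect Q f.
  move=> fi; rewrite -mulN1r -expectZ//; congr expect.
  by apply/funext => x; rewrite mulN1r.
by rewrite !N// expect_rcoord; lra.
Qed.
End moments.
End rotated_coordinates.

(** * Laws with couplings of arbitrarily small cost *)

Section closeness.
Context {R : realType} {d : nat}.
Implicit Types x y : 'cV[R]_d.

Lemma sqr_dist_ge0 x y : 0 <= sqr_dist x y.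
Proof. by apply: sumr_ge0 => i _; exact: sqr_ge0. Qed.

Lemma sqr_distC x y : sqr_dist x y = sqr_dist y x.
Proof. by apply: eq_bigr => i _; rewrite -sqrrN opprB. Qed.

Lemma measurable_sqr_dist d' (T : measurableType d') (f g : T -> Rd R d) :
  measurable_fun setT f -> measurable_fun setT g ->
  measurable_fun setT (fun t => sqr_dist (f t) (g t)).
Proof.
move=> mf mg; apply: measurable_sum => i; apply: measurable_funX.
by apply: measurable_funB; apply: (measurableT_comp (measurable_coord i)).
Qed.

Lemma open_sqr_dist_lt y (e : R) : open [set x : 'cV[R]_d | sqr_dist x y < e].
Proof.
rewrite (_ : [set _ | _] = (fun x => sqr_dist x y) @^-1` [set t | t < e])//.
apply: open_comp; last exact: open_lt.
move=> x _; apply: (@convex_continuous R d (fun x => sqr_dist x y)).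
move=> t u v t0 t1; rewrite /sqr_dist !mulr_sumr -big_split /=.
apply: ler_sum => i _; rewrite !mxE.
set p := u i ord0; set q := v i ord0; set r := y i ord0.
rewrite -subr_ge0 (_ : _ - _ = t * (1 - t) * (p - q) ^+ 2); last by ring.
by apply: mulr_ge0; [apply: mulr_ge0 => //; lra|exact: sqr_ge0].
Qed.

(** [V n] holds the points at squared distance at least 1 / (n + 1) from the complement of [U]. A
    coupled pair starting in [V n] ends in [U] unless it is that far apart, which has small
    probability; and the [V n] increase to [U]. *)
Lemma coupling_open_le (m1 m2 : probability (Rd R d) R) (U : set 'cV[R]_d) :
  (forall e : R, 0 < e -> exists2 Q, coupling m1 m2 Q &
    (\int[Q]_z (sqr_dist z.1 z.2)%:E <= e%:E)%E) ->
  open U -> (m1 U <= m2 U)%E.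
Proof.
move=> H oU.
pose V n : set (Rd R d) :=
  [set x : Rd R d | forall y, sqr_dist x y < n.+1%:R^-1 -> U y].
have mU : measurable (U : set (Rd R d)) by exact: measurable_open_Rd.
have mV n : measurable (V n).
  rewrite (_ : V n = ~` \bigcup_(y in ~` U) [set x | sqr_dist x y < n.+1%:R^-1]).
    apply: measurableC; apply: measurable_open_Rd.
    by apply: bigcup_open => y _; exact: open_sqr_dist_lt.
  apply/seteqP; split=> x /= h.
    by move=> [y Uy /= xy]; apply: Uy; exact: h.
  by move=> y xy; apply: contrapT => Uy; apply: h; exists y.
have UV : U = \bigcup_n V n.
  apply/seteqP; split=> [x Ux|x [n _ h]]; last first.
    apply: h; rewrite /sqr_dist big1 ?invr_gt0 ?ltr0n// => i _.
    by rewrite subrr expr0n.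
  have /nbhs_ballP[r /= r0 rU] := open_nbhs_nbhs (conj oU Ux).
  have r2 : 0 < r ^+ 2 by rewrite exprn_gt0.
  have [n nr] : exists n, n.+1%:R^-1 < r ^+ 2.
    have [n _ /(_ n (leqnn n)) /= nr] := near_infty_natSinv_lt (PosNum r2).
    by exists n.
  exists n => // y xy; apply: rU; split=> // i j; rewrite (ord1 j) /ball /=.
  rewrite -(@ltr_pXn2r _ 2)// ?nnegrE ?normr_ge0 ?ltW// real_normK ?num_real//.
  apply: le_lt_trans (lt_trans xy nr).
  by rewrite /sqr_dist (bigD1 i)//= lerDl sumr_ge0// => l _; exact: sqr_ge0.
have VU n : (m1 (V n) <= m2 U)%E.
  apply/lee_addgt0Pr => e e0.
  (* By Markov's inequality a cost of e / (n + 1) gives [W] probability at most [e]. *)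
  have de : 0 < e / n.+1%:R by rewrite divr_gt0// ltr0n.
  have [Q [Q1 Q2] Qe] := H _ de.
  pose W := [set z : Rd R d * Rd R d | n.+1%:R^-1 <= sqr_dist z.1 z.2].
  have mD : measurable_fun setT (fun z : Rd R d * Rd R d => sqr_dist z.1 z.2).
    by apply: measurable_sqr_dist; [exact: measurable_fst|exact: measurable_snd].
  have mW : measurable W.
    rewrite (_ : W = (fun z => sqr_dist z.1 z.2) @^-1` `[n.+1%:R^-1, +oo[%classic).
      by rewrite -[X in measurable X]setTI; exact: mD.
    by apply/seteqP; split=> z /=; rewrite in_itv/= andbT.
  have mfst : measurable (@fst (Rd R d) (Rd R d) @^-1` V n).
    by rewrite -[X in measurable X]setTI; exact: measurable_fst.
  have msnd : measurable (@snd (Rd R d) (Rd R d) @^-1` U).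
    by rewrite -[X in measurable X]setTI; exact: measurable_snd.
  rewrite -Q1// -Q2// /pushforward.
  apply: (@le_trans _ _ (Q ((@snd (Rd R d) (Rd R d) @^-1` U) `|` W))).
    apply: le_measure; rewrite ?inE//; first exact: measurableU.
    move=> z /= Vz; have [zd|zd] := ltP (sqr_dist z.1 z.2) n.+1%:R^-1.
      by left; exact: Vz.
    by right.
  apply: le_trans (measureU2 _ _ _) _ => //.
  rewrite leeD2l//.
  have : (n.+1%:R^-1%:E * Q W <= (e / n.+1%:R)%:E)%E.
    apply: le_trans Qe.
    rewrite -[X in Q X]setIT -integral_indic// -ge0_integralZl//; last first.
      by apply/measurable_EFinP; exact: measurable_indic.
    apply: ge0_le_integral => //.
    - by apply: emeasurable_funM => //; apply/measurable_EFinP; exact: measurable_indic.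
    - exact/measurable_EFinP.
    move=> z _; rewrite -EFinM lee_fin indicE; case: (boolP (z \in W)) => [/set_mem|_].
      by rewrite mulr1.
    by rewrite mulr0 sqr_dist_ge0.
  by rewrite mulrC EFinM lee_pmul2l// lte_fin invr_gt0 ltr0n.
have cV : m1 (V n) @[n --> \oo] --> m1 U.
  rewrite UV; apply: nondecreasing_cvg_mu => //.
    by rewrite -UV.
  move=> n p np; apply/subsetPset => x h y xy; apply: h.
  by apply: lt_le_trans xy _; rewrite lef_pV2 ?posrE ?ltr0n// ler_nat.
rewrite -(cvg_lim _ cV)//; apply: lime_le; first by apply/cvg_ex; exists (m1 U).
exact: nearW.
Qed.

(** Open sets are stable under intersection and generate the Borel sets; swapping the two components
    of the couplings gives the reverse inequality on them. *)
Lemma close_couplings_same_law (m1 m2 : probability (Rd R d) R) :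
  (forall e : R, 0 < e -> exists2 Q, coupling m1 m2 Q &
    (\int[Q]_z (sqr_dist z.1 z.2)%:E <= e%:E)%E) ->
  same_law m1 m2.
Proof.
move=> H B mB.
apply: (@g_sigma_algebra_measure_unique _ R (Rd R d) (@open 'cV[R]_d) _
  (fun=> setT) _ _ m1 m2) => //.
- by move=> U; exact: measurable_open_Rd.
- by move=> _; exact: openT.
- by rewrite bigcup_const.
- by move=> U V oU oV; exact: openI.
- move=> U oU; apply/eqP; rewrite eq_le; apply/andP; split.
    exact: coupling_open_le.
  apply: coupling_open_le => // e e0; have [Q [Q1 Q2] Qe] := H e e0.
  have msw : measurable_fun setT (fun z : Rd R d * Rd R d => (z.2, z.1)).
    by apply: measurable_fun_pair; [exact: measurable_snd|exact: measurable_fst].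
  exists (law Q msw); first by split=> A mA; [rewrite -Q2|rewrite -Q1].
  rewrite ge0_integral_law.
  + by under eq_integral do rewrite sqr_distC.
  + apply/measurable_EFinP; apply: measurable_sqr_dist.
      exact: measurable_fst.
    exact: measurable_snd.
  + by move=> z; rewrite lee_fin sqr_dist_ge0.
- by move=> _; exact: fin_num_fun_lty.
Qed.
End closeness.

(** * Square integrability of affine combinations *)

Section sqr_affine.
Context d (T : measurableType d) (R : realType) (Q : probability T R).

Lemma intg_sqr_affine (X Y : T -> R) (a b c : R) :
  measurable_fun setT X -> measurable_fun setT Y ->
  intg Q (fun x => X x ^+ 2) -> intg Q (fun x => Y x ^+ 2) ->
  intg Q (fun x => (a * X x + b * Y x + c) ^+ 2).
Proof.
move=> mX mY iX iY.
(* From (p + q + c)^2 <= 3 (p^2 + q^2 + c^2). *)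
apply: (@intg_le _ _ _ _ _
    (fun x => 3 * a ^+ 2 * X x ^+ 2 + 3 * b ^+ 2 * Y x ^+ 2 + 3 * c ^+ 2)).
- apply: measurable_funX; apply: measurable_funD => //.
  by apply: measurable_funD; exact: measurable_funM.
- apply: intgD; last exact: intg_cst.
  by apply: intgD; exact: intgZ.
move=> x; rewrite ger0_norm ?sqr_ge0//.
set p := a * X x; set q := b * Y x.
rewrite (_ : 3 * a ^+ 2 * X x ^+ 2 = 3 * p ^+ 2); last by rewrite /p; ring.
rewrite (_ : 3 * b ^+ 2 * Y x ^+ 2 = 3 * q ^+ 2); last by rewrite /q; ring.
have := sqr_ge0 (p - q); have := sqr_ge0 (p - c); have := sqr_ge0 (q - c).
by nra.
Qed.
End sqr_affine.

(** * The transport map and the key inequality *)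

Section gaussian_transport.
Context {R : realType} {d : nat}.
Variables (P : 'M[R]_d).
Hypothesis PP : P *m P^T = 1%:M.
Variable gamma : probability (Rd R d) R.
Hypothesis gammaP : is_standard_gaussian gamma.
Variables (mm mn : 'cV[R]_d) (a b : 'I_d -> R).
Hypotheses (a0 : forall i, 0 <= a i) (b0 : forall i, 0 <= b i).
Variables mu nu : probability (Rd R d) R.
Hypothesis muE : same_law mu (pushforward gamma (rgauss P mm a)).
Hypothesis nuE : same_law nu (pushforward gamma (rgauss P mn b)).

Let c i := Num.min (a i) (b i).
(* [k i] is 0 when [a i] is. *)
Let k i := c i / a i.

Definition transport (x : Rd R d) : Rd R d :=
  mn + P^T *m (diag_mx (\row_i k i) *m (P *m (x - mm))).

Lemma transport_rgauss z : transport (rgauss P mm a z) = rgauss P mn c z.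
Proof.
rewrite /transport /rgauss [mm + _]addrC addrK; congr (_ + _).
rewrite -!mulmxA; congr (_ *m _); rewrite (mulmxA P) PP mul1mx.
apply/colP => i; rewrite !mul_diag_mx !mxE mulrA; congr (_ * _).
(* k_i a_i = c_i also when a_i = 0, since b_i >= 0 then forces c_i = 0. *)
rewrite /k; have [az|an] := eqVneq (a i) 0; last by rewrite divfK.
rewrite az mulr0 /c az; apply/esym/eqP.
by rewrite minEle b0.
Qed.

Lemma measurable_transport : measurable_fun setT transport.
Proof.
pose M := P^T *m (diag_mx (\row_i k i) *m P).
rewrite (_ : transport = fun x : Rd R d => (mn - M *m mm) + M *m x).
  exact: measurable_affine.
apply/funext => x; rewrite /transport /M -!mulmxA -addrA; congr (_ + _).
by rewrite [RHS]addrC -!mulmxBr.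
Qed.

Lemma transport_law (mubar : probability (Rd R d) R) :
  same_law mubar (pushforward gamma (rgauss P mn c)) ->
  same_law mubar (pushforward mu transport).
Proof.
move=> h B mB; rewrite h// /pushforward muE; last first.
  by rewrite -[X in measurable X]setTI; exact: measurable_transport.
by congr (gamma _); apply/seteqP; split=> z /=; rewrite transport_rgauss.
Qed.

Let X i (x : Rd R d) := rcoord P mm i x.
Let Y i (y : Rd R d) := rcoord P mn i y.
Let e i := (P *m (mm - mn)) i ord0.

Let coordxT x i : (P *m (x - transport x)) i ord0 = (1 - k i) * X i x + e i.
Proof.
have -> : x - transport x = (x - mm) + (mm - mn) -
    P^T *m (diag_mx (\row_i k i) *m (P *m (x - mm))).
  by rewrite /transport opprD addrA [x - mm + _]addrA subrK.
rewrite mulmxBr mulmxDr (mulmxA P P^T) PP mul1mx mul_diag_mx /X /rcoord /e.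
by rewrite !mxE; ring.
Qed.

Let coordTy x y i : (P *m (transport x - y)) i ord0 = k i * X i x + -1 * Y i y.
Proof.
have -> : transport x - y =
    P^T *m (diag_mx (\row_i k i) *m (P *m (x - mm))) - (y - mn).
  by rewrite /transport opprB addrCA addrA.
rewrite mulmxBr (mulmxA P P^T) PP mul1mx mul_diag_mx /X /Y /rcoord.
by rewrite !mxE; ring.
Qed.

(** The last sum is <x - Tx, Tx - y> in the rotated coordinates, in which x - Tx has entries e_i +
    (1 - k_i) X_i. *)
Lemma sqr_dist_transport x y : sqr_dist x y =
  sqr_dist x (transport x) + sqr_dist (transport x) y +
  2 * \sum_i (e i + (1 - k i) * X i x) * (k i * X i x - Y i y).
Proof.
rewrite !(sqr_dist_rcoord PP) mulr_sumr -!big_split; apply: eq_bigr => i _ /=.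
have -> : x - y = (x - transport x) + (transport x - y) by rewrite addrA subrK.
by rewrite mulmxDr mxE coordxT coordTy; ring.
Qed.

Lemma intg_sqr_dist_transport : intg mu (fun x => sqr_dist x (transport x)).
Proof.
rewrite (_ : (fun _ => _) = fun x => \sum_i ((1 - k i) * X i x + 0 * X i x + e i) ^+ 2).
  apply: intg_sum => i; apply: intg_sqr_affine;
  by [exact: measurable_rcoord|exact: (intg_rcoord_sqr PP gammaP muE)].
apply/funext => x; rewrite (sqr_dist_rcoord PP); apply: eq_bigr => i _.
by rewrite coordxT mul0r addr0.
Qed.

(** Valid for every coupling, optimal or not. Dropping the second integral bounds the cost from
    below; keeping it measures how far a nearly optimal coupling is from the graph of the
    transport. *)
Lemma coupling_ge (eta : probability (Rd R d) R) Q : convex_le eta nu ->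
  coupling mu eta Q ->
  (\int[mu]_x (sqr_dist x (transport x))%:E +
   \int[Q]_z (sqr_dist (transport z.1) z.2)%:E <=
   \int[Q]_z (sqr_dist z.1 z.2)%:E)%E.
Proof.
move=> etanu [Q1 Q2].
have mQ1 : same_law mu (pushforward Q fst) by move=> B mB; rewrite Q1.
have mQ2 : same_law eta (pushforward Q snd) by move=> B mB; rewrite Q2.
have mf : measurable_fun setT (@fst (Rd R d) (Rd R d)) by exact: measurable_fst.
have ms : measurable_fun setT (@snd (Rd R d) (Rd R d)) by exact: measurable_snd.
have mX i : measurable_fun setT (X i) by exact: measurable_rcoord.
have mY i : measurable_fun setT (Y i) by exact: measurable_rcoord.
have mX1 i : measurable_fun setT (X i \o fst : Rd R d * Rd R d -> R).
  exact: (measurableT_comp (mX i)).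
have mY2 i : measurable_fun setT (Y i \o snd : Rd R d * Rd R d -> R).
  exact: (measurableT_comp (mY i)).
have mXX i : measurable_fun setT (fun x => X i x ^+ 2) by exact: measurable_funX.
have mYY i : measurable_fun setT (fun x => Y i x ^+ 2) by exact: measurable_funX.
have iX i : intg Q (fun z => (X i \o fst) z ^+ 2).
  apply/(intg_same_law mf mQ1 (mXX i)).
  exact: (intg_rcoord_sqr PP gammaP muE).
have iY i : intg Q (fun z => (Y i \o snd) z ^+ 2).
  apply/(intg_same_law ms mQ2 (mYY i)).
  exact: (convex_le_intg_sqr PP gammaP nuE).
have [cross_int cross_ge0] : (forall i, intg Q (fun z =>
      (e i + (1 - k i) * (X i \o fst) z) * (k i * (X i \o fst) z - (Y i \o snd) z))) /\
    (forall i, 0 <= expect Q (fun z =>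
      (e i + (1 - k i) * (X i \o fst) z) * (k i * (X i \o fst) z - (Y i \o snd) z))).
  apply/all_and2 => i.
  apply: (@cross_term_ge0 _ _ _ Q (X i \o fst) (Y i \o snd)
    (e i) (a i) (b i) normal_moment2) => //.
  - exact: normal_moment2_ge0.
  - by rewrite -(expect_same_law mf mQ1 (mX i)) (expect_rcoord PP gammaP muE).
  - by rewrite -(expect_same_law ms mQ2 (mY i)) (convex_le_expect PP gammaP nuE).
  - rewrite -(expect_same_law mf mQ1 (mXX i)).
    by rewrite (expect_rcoord_sqr PP gammaP muE).
  - rewrite -(expect_same_law ms mQ2 (mYY i)).
    exact: (convex_le_expect_sqr PP gammaP nuE).
have i1 : intg Q (fun z => sqr_dist z.1 (transport z.1)).
  have iT := intg_sqr_dist_transport.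
  exact/(intg_same_law mf mQ1 (intg_measurable iT))/iT.
have i2 : intg Q (fun z => sqr_dist (transport z.1) z.2).
  rewrite (_ : (fun _ => _) = fun z =>
      \sum_i (k i * (X i \o fst) z + -1 * (Y i \o snd) z + 0) ^+ 2).
    by apply: intg_sum => i; exact: intg_sqr_affine.
  apply/funext => z; rewrite (sqr_dist_rcoord PP); apply: eq_bigr => i _.
  by rewrite coordTy addr0.
have i3 := intgZ 2 (intg_sum (index_enum 'I_d) xpredT cross_int).
have E : (fun z : Rd R d * Rd R d => sqr_dist z.1 z.2) = fun z =>
    (sqr_dist z.1 (transport z.1) + sqr_dist (transport z.1) z.2) +
    2 * \sum_i (e i + (1 - k i) * (X i \o fst) z) *
      (k i * (X i \o fst) z - (Y i \o snd) z).
  by apply/funext => z; exact: sqr_dist_transport.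
rewrite (integral_same_law mf mQ1); last first.
  by apply/measurable_EFinP; exact: intg_measurable intg_sqr_dist_transport.
have i4 : intg Q (fun z => sqr_dist z.1 z.2).
  by rewrite E; apply: intgD => //; exact: intgD.
rewrite (expectE i1) (expectE i2) (expectE i4) -EFinD lee_fin E.
rewrite expectD//; last exact: intgD.
rewrite expectD// lerDl expectZ//; last exact: intg_sum.
by rewrite mulr_ge0// expect_sum//; apply: sumr_ge0 => i _.
Qed.

End gaussian_transport.

(** * Comparing Wasserstein distances through their squares *)

Section wasserstein.
Context {R : realType} {d : nat}.
Implicit Types mu eta : probability (Rd R d) R.

Definition transport_cost mu eta : \bar R :=
  ereal_inf [set \int[Q]_z (sqr_dist z.1 z.2)%:E | Q in coupling mu eta]%E.

Lemma transport_cost_ge0 mu eta : (0 <= transport_cost mu eta)%E.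
Proof.
apply: le_ereal_inf_tmp => _ [Q _ <-]; apply: integral_ge0 => z _.
by rewrite lee_fin sqr_dist_ge0.
Qed.

Lemma le_W2 mu eta (mu' eta' : probability (Rd R d) R) :
  (W2 mu eta <= W2 mu' eta')%E <-> (transport_cost mu eta <= transport_cost mu' eta')%E.
Proof.
have c0 := transport_cost_ge0 mu eta; have c'0 := transport_cost_ge0 mu' eta'.
have le_pow (x y : \bar R) r :
    0 <= r -> (0 <= x -> 0 <= y -> x <= y -> x `^ r <= y `^ r)%E.
  by move=> r0 x0 y0; apply: gt0_ler_poweR => //; rewrite in_itv/= ?x0 ?y0 leey.
split; last by move=> h; exact: le_pow.
move=> /(le_pow _ _ 2 (ltW (ltr0Sn _ 1)) (poweR_ge0 _ _) (poweR_ge0 _ _)).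
by rewrite -!poweRrM mulVf// !poweRe1.
Qed.

Lemma graph_coupling mu eta (f : Rd R d -> Rd R d) : measurable_fun setT f ->
  same_law eta (pushforward mu f) ->
  (transport_cost mu eta <= \int[mu]_x (sqr_dist x (f x))%:E)%E.
Proof.
move=> mf etaE.
have mg : measurable_fun setT (fun x => (x, f x)).
  by apply: measurable_fun_pair => //; exact: measurable_id.
apply: ereal_inf_lbound; exists (law mu mg).
  by split=> B mB; rewrite ?etaE.
rewrite ge0_integral_law//.
- apply/measurable_EFinP; apply: measurable_sqr_dist.
    exact: measurable_fst.
  exact: measurable_snd.
- by move=> z; rewrite lee_fin sqr_dist_ge0.
Qed.
End wasserstein.

(** * Optimality and uniqueness *)

Section backward_projection.
Context {R : realType} {d : nat}.
Variables (P : 'M[R]_d).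
Hypothesis PP : P *m P^T = 1%:M.
Variable gamma : probability (Rd R d) R.
Hypothesis gammaP : is_standard_gaussian gamma.
Variables (mm mn : 'cV[R]_d) (a b : 'I_d -> R).
Hypotheses (a0 : forall i, 0 <= a i) (b0 : forall i, 0 <= b i).
Variables mu nu mubar : probability (Rd R d) R.
Hypothesis muE : same_law mu (pushforward gamma (rgauss P mm a)).
Hypothesis nuE : same_law nu (pushforward gamma (rgauss P mn b)).
Hypothesis mubarE : same_law mubar
  (pushforward gamma (rgauss P mn (fun i => Num.min (a i) (b i)))).

Let T := transport P mm mn a b.
Let mT : measurable_fun setT T := measurable_transport P mm mn a b.
Let mubarT : same_law mubar (pushforward mu T) :=
  transport_law PP b0 muE mubarE.
Let w := (\int[mu]_x (sqr_dist x (T x))%:E)%E.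

Let w_fin : w \is a fin_num.
Proof.
have := intg_sqr_dist_transport PP gammaP mn b muE.
by move=> /(integrable_fin_num measurableT).
Qed.

Let mubar_nu : convex_le mubar nu.
Proof.
(* Here the shrinking factors are relative to nu, hence the division by [b i] and not by [a i]. *)
apply: (gaussian_convex_le gammaP (k := fun i => Num.min (a i) (b i) / b i) _ nuE).
  move=> i; apply/andP; split.
    by rewrite divr_ge0// le_min a0 b0.
  have [bz|bn] := eqVneq (b i) 0; first by rewrite bz invr0 mulr0.
  have bp : 0 < b i by rewrite lt_neqAle eq_sym bn b0.
  by rewrite ler_pdivrMr// mul1r ge_min lexx orbT.
move=> B mB; rewrite mubarE//; congr (pushforward gamma _ B).
apply/funext => z; rewrite /rgauss -!mulmxA; congr (_ + _ *m _).
apply/colP => i; rewrite !mul_diag_mx !mxE mulrA; congr (_ * _).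
have [bz|bn] := eqVneq (b i) 0; last by rewrite mulrC divfK.
rewrite bz mul0r; have := a0 i; rewrite le_eqVlt => /orP[/eqP <-|ai].
  by rewrite minxx.
by rewrite minC; case: ltP ai => // /le_lt_trans /[apply]; rewrite ltxx.
Qed.

Let cost_mubar : (transport_cost mu mubar <= w)%E.
Proof. exact: graph_coupling. Qed.

Let cost_ge eta : convex_le eta nu -> (w <= transport_cost mu eta)%E.
Proof.
move=> etanu; apply: le_ereal_inf_tmp => _ [Q hQ <-].
apply: le_trans (coupling_ge PP gammaP a0 b0 muE nuE etanu hQ).
by rewrite leeDl// integral_ge0// => z _; rewrite lee_fin sqr_dist_ge0.
Qed.

(** A coupling of [mu] and [eta] of cost below w + e satisfies E|Tx - y|^2 < e by [coupling_ge]; the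
    law of (Tx, y) then couples [mubar] and [eta] at cost less than [e]. *)
Let uniqueness eta : minimizes_W2_below mu nu eta -> same_law eta mubar.
Proof.
move=> [etanu /(_ mubar mubar_nu)/le_W2 le_eta].
have etaw : transport_cost mu eta = w.
  apply/eqP; rewrite eq_le cost_ge// andbT.
  exact: le_trans le_eta cost_mubar.
suff h : same_law mubar eta by move=> B mB; rewrite h.
apply: close_couplings_same_law => e e0.
have cfin : transport_cost mu eta \is a fin_num by rewrite etaw.
have [_ [Q hQ <-] Qw] := lb_ereal_inf_adherent e0 cfin.
have [Q1 Q2] := hQ.
have mg : measurable_fun setT (fun z : Rd R d * Rd R d => (T z.1, z.2)).
  apply: measurable_fun_pair; last exact: measurable_snd.
  by apply: (measurableT_comp mT); exact: measurable_fst.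
exists (law Q mg).
  split=> B mB; last by rewrite -Q2.
  rewrite mubarT// /pushforward -Q1//.
  by rewrite -[X in measurable X]setTI; exact: mT.
rewrite ge0_integral_law//; last 2 first.
- apply/measurable_EFinP; apply: measurable_sqr_dist.
    exact: measurable_fst.
  exact: measurable_snd.
- by move=> z; rewrite lee_fin sqr_dist_ge0.
have := coupling_ge PP gammaP a0 b0 muE nuE etanu hQ.
rewrite -/T -/w => /le_lt_trans /(_ Qw).
rewrite -/(transport_cost mu eta) etaw lteD2lE// => /ltW.
done.
Qed.

Lemma gaussian_backward_projection : is_backward_projection mu nu mubar.
Proof.
split; last exact: uniqueness.
split=> // eta etanu; apply/le_W2.
exact: le_trans cost_mubar (cost_ge etanu).
Qed.
End backward_projection.

(** * Square roots of the covariances *)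

Section covariance_square_root.
Context {R : realType} {d : nat}.
Variables (P : 'M[R]_d).
Hypothesis PP : P *m P^T = 1%:M.

Lemma rotated_diag_gram (a : 'I_d -> R) (A := P^T *m diag_mx (\row_i a i)) :
  A *m A^T = P^T *m diag_mx (\row_i a i ^+ 2) *m P.
Proof.
rewrite /A trmx_mul trmxK tr_diag_mx !mulmxA; congr (_ *m _).
rewrite -!mulmxA; congr (_ *m _).
by rewrite mulmx_diag; congr diag_mx; apply/rowP => i; rewrite !mxE.
Qed.

Lemma is_gaussian_diag_ge0 m (S : 'M[R]_d) mu i :
  is_gaussian m S mu -> 0 <= (P *m S *m P^T) i i.
Proof.
move=> [_ [A [_ <- _]]].
rewrite mulmxA -(mulmxA _ A^T) -trmx_mul mxE; apply: sumr_ge0 => j _.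
by rewrite [X in _ * X]mxE -expr2 sqr_ge0.
Qed.

Lemma diag_unrotate (S D : 'M[R]_d) : P *m S *m P^T = D -> is_diag_mx D ->
  S = P^T *m diag_mx (\row_i D i i) *m P.
Proof.
move=> PSP dD.
have -> : diag_mx (\row_i D i i) = D.
  apply/matrixP => i j; rewrite !mxE; have [->|ij] := eqVneq i j.
    by rewrite mulr1n.
  by rewrite mulr0n (is_diag_mxP dD).
rewrite -PSP !mulmxA (mulmx1C PP) mul1mx -mulmxA.
by rewrite (mulmx1C PP) mulmx1.
Qed.
End covariance_square_root.

(** Both properties of [mubar] depend only on its values on measurable sets, hence an equivalence in
    place of an equality; the separate existence statement keeps it from being vacuous. *)
Theorem proposition18 (R : realType) (d : nat)
    (m_mu m_nu : 'cV[R]_d) (S_mu S_nu P : 'M[R]_d)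
    (mu nu : probability (Rd R d) R) :
  is_gaussian m_mu S_mu mu -> is_gaussian m_nu S_nu nu ->
  S_mu *m S_nu = S_nu *m S_mu ->
  P *m P^T = 1%:M ->
  let D_mu := P *m S_mu *m P^T in
  let D_nu := P *m S_nu *m P^T in
  is_diag_mx D_mu -> is_diag_mx D_nu ->
  let D_bar := map2_mx Num.min D_mu D_nu in
  let S_bar := P^T *m D_bar *m P in
  (exists mubar : probability (Rd R d) R, is_gaussian m_nu S_bar mubar) /\
  (forall mubar : probability (Rd R d) R,
     is_backward_projection mu nu mubar <-> is_gaussian m_nu S_bar mubar).
Proof.
move=> Gmu Gnu _ PP D_mu D_nu dmu dnu D_bar S_bar.
pose a i := Num.sqrt (D_mu i i); pose b i := Num.sqrt (D_nu i i).
have Dmu0 i : 0 <= D_mu i i by exact: is_gaussian_diag_ge0 Gmu.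
have Dnu0 i : 0 <= D_nu i i by exact: is_gaussian_diag_ge0 Gnu.
have S_muE : (P^T *m diag_mx (\row_i a i)) *m (P^T *m diag_mx (\row_i a i))^T = S_mu.
  rewrite rotated_diag_gram [RHS](diag_unrotate PP erefl dmu).
  by congr (_ *m diag_mx _ *m _); apply/rowP => i; rewrite mxE [RHS]mxE sqr_sqrtr.
have S_nuE : (P^T *m diag_mx (\row_i b i)) *m (P^T *m diag_mx (\row_i b i))^T = S_nu.
  rewrite rotated_diag_gram [RHS](diag_unrotate PP erefl dnu).
  by congr (_ *m diag_mx _ *m _); apply/rowP => i; rewrite mxE [RHS]mxE sqr_sqrtr.
pose c i := Num.min (a i) (b i).
have S_barE : (P^T *m diag_mx (\row_i c i)) *m (P^T *m diag_mx (\row_i c i))^T = S_bar.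
  rewrite rotated_diag_gram /S_bar; congr (_ *m _ *m _).
  (* By monotonicity of the square root, c_i^2 is the minimum of the two diagonal entries; off the
     diagonal the minimum is that of 0 and 0. *)
  apply/matrixP => i j; rewrite mxE [X in X *+ _]mxE [RHS]mxE.
  have [<-|ij] := eqVneq i j.
    rewrite mulr1n /c /a /b; case: (leP (D_mu i i) (D_nu i i)) => [mn|/ltW nm].
      by rewrite min_l ?ler_wsqrtr// sqr_sqrtr.
    by rewrite min_r ?ler_wsqrtr// sqr_sqrtr.
  by rewrite mulr0n (is_diag_mxP dmu)// (is_diag_mxP dnu)// minxx.
(* The standard Gaussian law behind [mu] is made to carry [nu] and [mubar] as well. *)
have [gamma [A [gammaP _ _]]] := Gmu.
have muE := gaussian_law gammaP Gmu S_muE.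
have nuE := gaussian_law gammaP Gnu S_nuE.
have barP mubar : is_gaussian m_nu S_bar mubar <->
    same_law mubar (pushforward gamma (rgauss P m_nu c)).
  split=> [Gbar|barE]; first exact: (gaussian_law gammaP Gbar S_barE).
  by exists gamma, (P^T *m diag_mx (\row_i c i)).
have proj (mubar : probability (Rd R d) R) :
    same_law mubar (pushforward gamma (rgauss P m_nu c)) ->
    is_backward_projection mu nu mubar.
  move=> barE; apply: (gaussian_backward_projection PP gammaP _ _ muE nuE barE) => i;
    exact: sqrtr_ge0.
pose mubar0 := law gamma (measurable_rgauss P m_nu c).
have bar0E : same_law mubar0 (pushforward gamma (rgauss P m_nu c)) by [].
split; first by exists mubar0; exact/barP.
move=> mubar; split=> [[_ uniq]|/barP]; last exact: proj.
(* The Gaussian [mubar0] is itself a minimizer, so the uniqueness clause for [mubar] identifies the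
   two laws. *)
apply/barP => B mB; rewrite -(uniq _ (proj _ bar0E).1)//.
Qed.
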